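(* Let $\mu$ be a bounded perturbation of the uniform distribution on $[a,b]$, let $n\ge1$ be an integer, and let $(X_P,w_P)$ be the Poincaré quadrature of $H^1(\mu)$ with $n$ nodes and order $M=2n-1$. Then $\mathrm{wce}(X_P,w_P,K_M)=0$ and $(X_P,w_P)$ is an optimal kernel quadrature for $\mathcal{H}_{K_M}$, with positive weights. Conversely, if $(X,w)$, with $n$ nodes, is a kernel quadrature for $\mathcal{H}_{K_M}$ such that $\mathrm{wce}(X,w,K_M)=0$ and the weights are positive, then $X=X_P$ and $w=w_P$ (up to a common reordering of nodes and weights). Furthermore, $w_P$ minimizes over all (possibly negative) weights the worst-case error given $X_P$: $$w_P=w^\star(X_P,K_M)=\mathrm{argmin}_{w\in\mathbb{R}^n}\ \mathrm{wce}(X_P,w,K_M).$$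
   Context: Let $-\infty<a<b<\infty$. A probability distribution $\mu$ on $[a,b]$ is a bounded perturbation of the uniform distribution if it has a density $\rho$ that is positive, continuous and piecewise $C^1$ on $[a,b]$. Write $\|f\|^2=\int_a^b f^2\,d\mu$, $\langle f,g\rangle=\int_a^b fg\,d\mu$, $H^1(\mu)=\{f\in L^2(\mu): f'\in L^2(\mu)\}$ (weak derivatives; elements identified with their continuous representatives), with norm $\|f\|_{H^1(\mu)}^2=\|f\|^2+\|f'\|^2$. Poincaré basis: the problem of finding $f\in H^1(\mu)$ and $\lambda$ with $\langle f',g'\rangle=\lambda\langle f,g\rangle$ for all $g\in H^1(\mu)$ has simple eigenvalues $0=\lambda_0<\lambda_1<\cdots\to\infty$; the $L^2(\mu)$-normalized eigenfunctions $(\varphi_m)_{m\ge0}$ (unique up to sign, $\varphi_0=1$) form an orthonormal basis of $L^2(\mu)$ and are continuous. Set $\alpha_m=(1+\lambda_m)^{-1}$ and $K_M(x,y)=\sum_{m=0}^M\alpha_m\varphi_m(x)\varphi_m(y)$; $\mathcal{H}_{K_M}$ is the reproducing kernel Hilbert space with kernel $K_M$, i.e. $\mathrm{span}(\varphi_0,\dots,\varphi_M)$ with the norm of $H^1(\mu)$. A quadrature with $n$ nodes is a pair $(X,w)$ with $X=(x_1,\dots,x_n)\in[a,b]^n$ and $w=(w_1,\dots,w_n)\in\mathbb{R}^n$; it is exact for $f$ if $\int f\,d\mu=\sum_i w_if(x_i)$. The Poincaré quadrature $(X_P,w_P)$ with $n$ nodes (order $2n-1$) is the unique quadrature with $n$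 nodes and positive weights that is exact for $\varphi_0,\dots,\varphi_{2n-1}$ (existence and uniqueness are known because the Poincaré basis is, up to signs, a Tchebytchev system; its nodes are distinct and in $(a,b)$). For a kernel $\kappa$ with reproducing kernel Hilbert space $\mathcal{H}_\kappa$, $\mathrm{wce}(X,w,\kappa)=\sup_{h\in\mathcal{H}_\kappa,\|h\|_{\mathcal{H}_\kappa}\le1}\left|\int h\,d\mu-\sum_{i=1}^n w_ih(x_i)\right|$. For a set $X$ of $n$ distinct nodes whose Gram matrix $(\kappa(x_i,x_j))_{i,j}$ is invertible, $w^\star(X,\kappa)$ denotes the unique minimizer of $w\mapsto\mathrm{wce}(X,w,\kappa)$ over $\mathbb{R}^n$, and the kernel quadrature associated to $X$ on $\mathcal{H}_\kappa$ is $(X,w^\star(X,\kappa))$. An optimal kernel quadrature is a quadrature minimizing $\mathrm{wce}(X,w,\kappa)$ among all quadratures $(X,w)$ with $n$ nodes. *)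

(* Defs.v *)
From HB Require Import structures.
From mathcomp Require Export all_boot all_order all_fingroup all_algebra.
From mathcomp Require Export all_classical all_reals all_analysis.

Set Implicit Arguments.
Unset Strict Implicit.
Unset Printing Implicit Defensive.

Export Order.TTheory GRing.Theory Num.Theory numFieldNormedType.Exports.

Local Open Scope classical_set_scope.
Local Open Scope ring_scope.

(* Functions on [a, b] are encoded as functions R -> R whose values outside
   [a, b] are irrelevant: every notion below only looks at them on [a, b]. *)

Section FunctionSpaces.
Context {R : realType}.
Local Notation leb := (@lebesgue_measure R).

Definition piecewise_C1 (a b : R) (rho : R -> R) : Prop :=
  exists (k : nat) (t : nat -> R), [/\ t 0%N = a, t k = b &
    forall i, (i < k)%N -> t i < t i.+1 /\
      exists d : R -> R, {within `[t i, t i.+1], continuous d} /\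
        forall x, x \in `]t i, t i.+1[ -> is_derive x 1 rho (d x)].

(* The first clause says that mu has density rho 1_[a, b] with respect to the
   Lebesgue measure; in particular mu is carried by [a, b]. *)
Definition bounded_perturbation_of_uniform (a b : R)
    (mu : probability (measurableTypeR R) R) : Prop :=
  exists rho : R -> R,
    [/\ forall A : set (measurableTypeR R), measurable A ->
          mu A = (\int[leb]_(x in A `&` `[a, b]) (rho x)%:E)%E,
        forall x, x \in `[a, b] -> 0 < rho x,
        {within `[a, b], continuous rho} &
        piecewise_C1 a b rho].

(* Test functions of class C^1 with compact support in ]a, b[. *)
Definition test_function (a b : R) (psi : R -> R) : Prop :=
  [/\ forall x, derivable psi x 1,
      continuous (derive1 psi) &
      exists c d : R, [/\ a < c, d < b &
        forall x, x \notin `[c, d] -> psi x = 0]].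

Definition weak_derivative (a b : R) (f df : R -> R) : Prop :=
  forall psi, test_function a b psi ->
    \int[leb]_(x in `[a, b]) (f x * derive1 psi x) =
    - \int[leb]_(x in `[a, b]) (df x * psi x).

Definition L2 (a b : R) (mu : probability (measurableTypeR R) R)
    (f : R -> R) : Prop :=
  measurable_fun (`[a, b] : set (measurableTypeR R)) f /\
  mu.-integrable `[a, b] (fun x => (f x ^+ 2)%:E).

Definition dotL2 (a b : R) (mu : probability (measurableTypeR R) R)
    (f g : R -> R) : R :=
  \int[mu]_(x in `[a, b]) (f x * g x).

(* f is the continuous representative of an element of H^1(mu) and df is a
   version of its weak derivative. *)
Definition H1 (a b : R) (mu : probability (measurableTypeR R) R)
    (f df : R -> R) : Prop :=
  [/\ {within `[a, b], continuous f}, L2 a b mu f, L2 a b mu df &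
      weak_derivative a b f df].

Definition poincare_eigen (a b : R) (mu : probability (measurableTypeR R) R)
    (l : R) (f : R -> R) : Prop :=
  exists df, H1 a b mu f df /\
    forall g dg, H1 a b mu g dg ->
      dotL2 a b mu df dg = l * dotL2 a b mu f g.

(* The eigenvalues, listed in increasing order, and the normalized
   eigenfunctions of the Poincare problem. *)
Record poincare_basis (a b : R) (mu : probability (measurableTypeR R) R)
    (lambda : nat -> R) (phi : nat -> R -> R) : Prop := PoincareBasis {
  pb_lambda0 : lambda 0%N = 0;
  pb_lambda_lt : forall m, lambda m < lambda m.+1;
  pb_lambda_pinfty : lambda @ \oo --> +oo;
  pb_eigen : forall m, poincare_eigen a b mu (lambda m) (phi m);
  (* there is no other eigenvalue, and the eigenvalues are simple *)
  pb_simple : forall l f, poincare_eigen a b mu l f ->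
    (exists2 x, x \in `[a, b] & f x != 0) ->
    exists (m : nat) (c : R), l = lambda m /\
      forall x, x \in `[a, b] -> f x = c * phi m x;
  pb_phi0 : forall x, x \in `[a, b] -> phi 0%N x = 1;
  pb_orthonormal : forall i j, dotL2 a b mu (phi i) (phi j) = (i == j)%:R;
  pb_total : forall f, L2 a b mu f ->
    (fun N => let r x := f x - \sum_(m < N) dotL2 a b mu f (phi m) * phi m x in
              dotL2 a b mu r r) @ \oo --> 0
}.

Definition KM (lambda : nat -> R) (phi : nat -> R -> R) (M : nat) (x y : R) : R :=
  \sum_(m < M.+1) (1 + lambda m)^-1 * phi m x * phi m y.

(* Real Hilbert space of functions on D with reproducing kernel kappa.  Being
   null in the space amounts to vanishing on D, so that functions that agree
   on D are identified. *)
Record rkhs (D : set R) (kappa : R -> R -> R) := RKHS {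
  rk_mem : set (R -> R);
  rk_dot : (R -> R) -> (R -> R) -> R;
  rk_mem0 : rk_mem (fun=> 0);
  rk_memL : forall c f g, rk_mem f -> rk_mem g ->
    rk_mem (fun x => c * f x + g x);
  rk_dotC : forall f g, rk_mem f -> rk_mem g -> rk_dot f g = rk_dot g f;
  rk_dotL : forall c f g h, rk_mem f -> rk_mem g -> rk_mem h ->
    rk_dot (fun x => c * f x + g x) h = c * rk_dot f h + rk_dot g h;
  rk_dot_ge0 : forall f, rk_mem f -> 0 <= rk_dot f f;
  rk_dot_eq0 : forall f, rk_mem f ->
    (rk_dot f f = 0 <-> forall x, D x -> f x = 0);
  rk_complete : forall u : nat -> R -> R, (forall k, rk_mem (u k)) ->
    (forall e : R, 0 < e -> exists N, forall p q, (N <= p)%N -> (N <= q)%N ->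
       (let r x := u p x - u q x in Num.sqrt (rk_dot r r)) < e) ->
    exists2 f, rk_mem f &
      (fun k => let r x := u k x - f x in Num.sqrt (rk_dot r r)) @ \oo --> 0;
  rk_kernel : forall x, D x -> rk_mem (kappa x);
  rk_reproducing : forall f x, rk_mem f -> D x -> rk_dot f (kappa x) = f x
}.

Definition rk_norm (D : set R) (kappa : R -> R -> R) (H : rkhs D kappa)
    (f : R -> R) : R := Num.sqrt (rk_dot H f f).

End FunctionSpaces.

Section Quadratures.
Context {R : realType}.

Definition nodes_in (a b : R) (n : nat) (X : 'rV[R]_n) : Prop :=
  forall i, X 0 i \in `[a, b].

Definition distinct_nodes (n : nat) (X : 'rV[R]_n) : Prop :=
  injective (fun i => X 0 i).

Definition quad (n : nat) (X w : 'rV[R]_n) (f : R -> R) : R :=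
  \sum_(i < n) w 0 i * f (X 0 i).

Definition exact_for (a b : R) (mu : probability (measurableTypeR R) R)
    (n : nat) (X w : 'rV[R]_n) (f : R -> R) : Prop :=
  \int[mu]_(x in `[a, b]) f x = quad X w f.

(* Uniqueness up to reordering is a theorem, not part of the definition. *)
Definition poincare_quadrature (a b : R)
    (mu : probability (measurableTypeR R) R) (phi : nat -> R -> R)
    (n : nat) (X w : 'rV[R]_n) : Prop :=
  [/\ nodes_in a b X, distinct_nodes X, forall i, 0 < w 0 i &
      forall m, (m <= 2 * n - 1)%N -> exact_for a b mu X w (phi m)].

Definition wce (a b : R) (mu : probability (measurableTypeR R) R)
    (kappa : R -> R -> R) (H : rkhs `[a, b] kappa)
    (n : nat) (X w : 'rV[R]_n) : \bar R :=
  ereal_sup [set `| (\int[mu]_(x in `[a, b]) h x) - quad X w h |%:E |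
             h in [set h | rk_mem H h /\ rk_norm H h <= 1]].

Definition gram (kappa : R -> R -> R) (n : nat) (X : 'rV[R]_n) : 'M[R]_n :=
  \matrix_(i, j) kappa (X 0 i) (X 0 j).

(* w is the unique minimizer of v |-> wce(X, v, kappa). *)
Definition optimal_weights (a b : R)
    (mu : probability (measurableTypeR R) R) (kappa : R -> R -> R)
    (H : rkhs `[a, b] kappa) (n : nat) (X w : 'rV[R]_n) : Prop :=
  forall v : 'rV[R]_n,
    (forall u : 'rV[R]_n, (wce mu H X v <= wce mu H X u)%E) <-> v = w.

Definition kernel_quadrature (a b : R)
    (mu : probability (measurableTypeR R) R) (kappa : R -> R -> R)
    (H : rkhs `[a, b] kappa) (n : nat) (X w : 'rV[R]_n) : Prop :=
  [/\ nodes_in a b X, distinct_nodes X, gram kappa X \in unitmx &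
      optimal_weights mu H X w].

Definition optimal_quadrature (a b : R)
    (mu : probability (measurableTypeR R) R) (kappa : R -> R -> R)
    (H : rkhs `[a, b] kappa) (n : nat) (X w : 'rV[R]_n) : Prop :=
  nodes_in a b X /\
  forall Y v : 'rV[R]_n, nodes_in a b Y -> (wce mu H X w <= wce mu H Y v)%E.

End Quadratures.

(* Main.v *)
Require Import Defs.
From mathcomp Require Import ring lra zify measurable_realfun.
Set Implicit Arguments.
Unset Strict Implicit.
Unset Printing Implicit Defensive.
Local Open Scope classical_set_scope.
Local Open Scope ring_scope.

(* The heart of the matter is Sturm's theorem: a nonzero combination of
   phi_0, ..., phi_N has at most N zeros in [a, b].  Writing L for the operator
   - (rho f')' / rho, Rolle's theorem applied to u and then to rho u', which
   also vanishes at a and b, shows that L u has at least as many zeros as u.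
   Iterating, L^k u / lambda_N^k tends in C^1 to a multiple of phi_N, whose zeros
   are simple, so phi_N has at least as many zeros as u.  Finally phi_N has at
   most N zeros by Courant's argument: with N + 1 zeros, some combination of the
   restrictions of phi_N to its first N + 1 nodal intervals would be orthogonal
   to phi_0, ..., phi_(N-1) with Rayleigh quotient lambda_N, hence be a multiple
   of phi_N, although it vanishes on the last nodal interval.
   Point evaluations at 2n distinct nodes are therefore independent on
   span(phi_0, ..., phi_(2n-1)), which is the space of K_(2n-1): the difference of
   two exact quadratures with n nodes vanishes, and so does the difference of two
   weight vectors with the same nodes. *)

(** * Real analysis *)

Section RealAnalysis.
Context {R : realType}.
Local Notation leb := (@lebesgue_measure R).
Implicit Types (a b c d x y : R) (f g h F G : R -> R).

(** The data live on [a, b]: an eigenfunction is continuous there, solves its equation weakly, and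
    is arbitrary elsewhere. Each one is therefore replaced by a C^1 function [e] on the whole line
    that agrees with it on [a, b]. Composing with [clamp] extends the density and the right-hand
    side of the equation by their boundary values, so that all derivatives are two-sided. The
    derivative of the density may jump, hence so may e''; the equation is kept as a first-order
    system for [e] and its flux [p], which is differentiable everywhere. Zeros are counted without
    multiplicity. This survives the limit because [e] and [p] have no common zero, by uniqueness for
    the first-order system. Iterating the operator gives no bound by itself, as it only compares a
    combination with its top eigenfunction; the bound comes from the variational side, where
    completeness of the basis enters through Parseval's identity. *)

Definition clamp a b x := Num.max a (Num.min b x).

Lemma clamp_itv a b x : a <= b -> clamp a b x \in `[a, b].
Proof. by move=> ab; rewrite in_itv/= /clamp le_max lexx/= ge_max ab ge_min lexx. Qed.

Lemma clamp_id a b x : x \in `[a, b] -> clamp a b x = x.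
Proof.
by rewrite in_itv/= => /andP[ax xb]; rewrite /clamp (min_idPr xb) (max_idPr ax).
Qed.

Lemma continuous_clamp a b : continuous (clamp a b).
Proof.
move=> x; apply: (@continuous_max _ _ (fun=> a) (fun x => Num.min b x)).
  exact: cvg_cst.
by apply: (@continuous_min _ _ (fun=> b) (fun x => x)); [exact: cvg_cst|exact: cvg_id].
Qed.

Lemma continuous_comp_clamp a b f : a <= b ->
  {within `[a, b], continuous f} -> continuous (f \o clamp a b).
Proof.
move=> ab /subspace_continuousP cf x.
have xab : `[a, b]%classic (clamp a b x) by exact: clamp_itv.
apply: cvg_comp (cf _ xab).
move=> A; rewrite /within/= => nA.
have /= nB := @continuous_clamp a b x _ nA.
near=> y; have /= : (fun z => `[a, b]%classic z -> A z) (clamp a b y) by near: y.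
by apply; exact: clamp_itv.
Unshelve. all: by end_near. Qed.

Lemma is_derive_continuous f (df : R -> R) :
  (forall x, is_derive x 1 f (df x)) -> continuous f.
Proof. by move=> H x; apply: differentiable_continuous; apply/derivable1_diffP. Qed.

Lemma continuous_sqr f : continuous f -> continuous (fun x => f x ^+ 2).
Proof. by move=> cf x; under eq_fun do rewrite expr2; apply: cvgM; exact: cf. Qed.

Lemma is_deriveDx f g x (df dg : R) :
  is_derive x 1 f df -> is_derive x 1 g dg ->
  is_derive x 1 (fun y => f y + g y) (df + dg).
Proof. by move=> ? ?; exact: is_deriveD. Qed.

Lemma is_deriveBx f g x (df dg : R) :
  is_derive x 1 f df -> is_derive x 1 g dg ->
  is_derive x 1 (fun y => f y - g y) (df - dg).
Proof. by move=> ? ?; exact: is_deriveB. Qed.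

Lemma is_deriveMx f g x (df dg : R) :
  is_derive x 1 f df -> is_derive x 1 g dg ->
  is_derive x 1 (fun y => f y * g y) (df * g x + f x * dg).
Proof.
move=> Df Dg; apply: (is_derive_eq (is_deriveM Df Dg)).
by rewrite addrC; congr (_ + _); rewrite /GRing.scale/= mulrC.
Qed.

Lemma is_deriveNx f x (df : R) :
  is_derive x 1 f df -> is_derive x 1 (fun y => - f y) (- df).
Proof. by move=> Df; exact: is_deriveN. Qed.

Lemma is_deriveZx f x c (df : R) :
  is_derive x 1 f df -> is_derive x 1 (fun y => c * f y) (c * df).
Proof. by move=> Df; exact: is_deriveZ. Qed.

Lemma is_derive_sumx n (f : nat -> R -> R) (df : nat -> R) x :
  (forall i, (i < n)%N -> is_derive x 1 (f i) (df i)) ->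
  is_derive x 1 (fun y => \sum_(i < n) f i y) (\sum_(i < n) df i).
Proof.
elim: n => [|n IH] H.
  rewrite big_ord0; under eq_fun do rewrite big_ord0; exact: is_derive_cst.
rewrite big_ord_recr/=; under eq_fun do rewrite big_ord_recr/=.
apply: is_deriveDx; last exact: H.
by apply: IH => i /ltnW; exact: H.
Qed.

Lemma continuous_itv_integrable f c d : continuous f ->
  leb.-integrable `[c, d] (EFin \o f).
Proof.
move=> cf; apply: continuous_compact_integrable; first exact: segment_compact.
exact: continuous_subspaceT.
Qed.

(** An integral from a base point yields a derivative only to the right of that point. Once the
    constant [c0] is subtracted, the integral from [t - 1] is zero up to [t], so its derivative is
    right on the left side too. *)
Let primitive_left h t c0 : continuous h -> (forall x, x <= t -> h x = c0) ->
  exists F, forall x, is_derive x 1 F (h x).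
Proof.
move=> ch hc; pose k x := h x - c0.
have ck : continuous k by move=> x; apply: cvgB; [exact: ch|exact: cvg_cst].
pose P x := \int[leb]_(y in `[t - 1, x]) k y.
have dP x : is_derive x 1 P (k x).
  have [xt|tx] := ltP x t.
    have -> : k x = 0 by rewrite /k hc ?subrr// ltW.
    apply: (@near_eq_is_derive _ _ _ (fun=> 0 : R)).
    near=> y; rewrite /P (@eq_Rintegral _ _ _ _ _ (fun=> 0 : R)).
      by rewrite Rintegral_cst//= mul0r.
    move=> z; rewrite inE/= in_itv/= => /andP[_ zy].
    rewrite /k hc ?subrr// (le_trans zy)//.
    by apply: ltW; near: y; exact: lt_nbhsl.
  have [] := @continuous_FTC1_closed R k (t - 1) x (x + 1) _ _ _ (ck x).
  - by rewrite ltrDl.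
  - exact: continuous_itv_integrable.
  - by rewrite (lt_le_trans _ tx)// ltrBlDr ltrDl.
  by move=> dF <-; rewrite derive1E; apply/derivableP.
exists (fun x => P x + c0 * x) => x.
apply: (is_derive_eq (is_deriveDx (dP x) (is_deriveZx c0 (is_derive_id x 1)))).
by rewrite /k mulr1 subrK.
Unshelve. all: by end_near. Qed.

(** Writing h x = h (max 0 x) + h (- max 0 (- x)) - h 0 splits [h] into two functions, each constant
    on a half-line. The second one is handled after the reflection x -> - x. *)
Lemma continuous_primitive h : continuous h ->
  exists F, forall x, is_derive x 1 F (h x).
Proof.
move=> ch.
have cM : continuous (fun x : R => h (Num.max 0 x)).
  move=> x; apply: (@continuous_comp _ _ _ (fun x => Num.max 0 x) h); last exact: ch.
  by apply: (@continuous_max _ _ (fun=> 0) (fun x => x)); [exact: cvg_cst|exact: cvg_id].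
have cm : continuous (fun x : R => h (- Num.max 0 x)).
  move=> x; apply: (@continuous_comp _ _ _ (fun x => - Num.max 0 x) h); last exact: ch.
  apply: cvgN.
  by apply: (@continuous_max _ _ (fun=> 0) (fun x => x)); [exact: cvg_cst|exact: cvg_id].
have [|F1 dF1] := @primitive_left _ 0 (h 0) cM.
  by move=> x x0; rewrite (max_idPl x0).
have [|F2 dF2] := @primitive_left _ 0 (h 0) cm.
  by move=> x x0; rewrite (max_idPl x0) oppr0.
exists (fun x => F1 x - (F2 (- x)) - h 0 * x) => x.
have dN : is_derive x 1 (fun x => F2 (- x)) (- h (- Num.max 0 (- x))).
  have H : is_derive x 1 (fun y : R => - y) (- 1) := is_deriveN (is_derive_id x 1).
  apply: is_derive_eq (is_derive1_comp (dF2 (- x)) H) _.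
  by rewrite mulrN1.
apply: (is_derive_eq (is_deriveBx (is_deriveBx (dF1 x) dN)
  (is_deriveZx (h 0) (is_derive_id x 1)))).
rewrite mulr1 opprK.
have [x0|x0] := leP 0 x.
  rewrite (max_idPl _) ?oppr_le0// oppr0; ring.
rewrite (max_idPr _) ?oppr_ge0 ?ltW// opprK; ring.
Qed.

Lemma by_parts F G f g c d : c <= d -> continuous f -> continuous g ->
  (forall x, is_derive x 1 F (f x)) -> (forall x, is_derive x 1 G (g x)) ->
  \int[leb]_(x in `[c, d]) (F x * g x) =
  F d * G d - F c * G c - \int[leb]_(x in `[c, d]) (f x * G x).
Proof.
move=> + cf cg dF dG; rewrite le_eqVlt => /predU1P[->|cd].
  by rewrite set_itv1 !Rintegral_set1 !subrr.
have LR H (h : R -> R) : (forall x, is_derive x 1 H (h x)) ->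
    derivable_oo_LRcontinuous H c d.
  move=> dH; have cH := is_derive_continuous dH.
  split => [x _|//|]; first exact: ex_derive.
    exact: cvg_at_right_filter (cH c).
  exact: cvg_at_left_filter (cH d).
apply: Rintegration_by_parts => //; try exact: continuous_subspaceT; try exact: LR.
  by move=> x _; rewrite derive1E derive_val.
by move=> x _; rewrite derive1E derive_val.
Qed.

End RealAnalysis.

(** * Monotone primitives, tent functions and the du Bois-Reymond lemma *)

Section MoreRealAnalysis.
Context {R : realType}.
Local Notation leb := (@lebesgue_measure R).
Implicit Types (a b c d x y : R) (f g h F G H : R -> R).

Lemma ftc2 G g c d : c <= d -> continuous g ->
  (forall x, is_derive x 1 G (g x)) ->
  \int[leb]_(x in `[c, d]) g x = G d - G c.
Proof.
move=> cd cg dG.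
have c0 : continuous (fun _ : R => 0 : R) by move=> x; exact: cvg_cst.
have d1 x : is_derive x 1 (fun=> 1 : R) (0 : R) by exact: is_derive_cst.
have := by_parts cd c0 cg d1 dG.
under eq_Rintegral do rewrite mul1r.
under [Y in _ = _ - Y -> _]eq_Rintegral do rewrite mul0r.
by rewrite Rintegral_cst//= mul0r subr0 !mul1r.
Qed.

Lemma derive_ge0_le F (f : R -> R) c d : c <= d ->
  (forall x, is_derive x 1 F (f x)) -> (forall x, x \in `]c, d[ -> 0 <= f x) ->
  F c <= F d.
Proof.
move=> cd dF f0; have cF := is_derive_continuous dF.
move: cd; rewrite le_eqVlt => /predU1P[->//|cd].
have [z zcd] := MVT cd (fun x _ => dF x) (continuous_subspaceT cF).
by move=> e; rewrite -subr_ge0 e mulr_ge0 ?f0// subr_ge0 ltW.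
Qed.

Lemma derive0_eq F (f : R -> R) c d : c <= d ->
  (forall x, is_derive x 1 F (f x)) -> (forall x, x \in `]c, d[ -> f x = 0) ->
  F c = F d.
Proof.
move=> cd dF f0; apply/eqP; rewrite eq_le; apply/andP; split.
  by apply: derive_ge0_le dF _ => // x /f0->.
rewrite -lerN2; apply: (@derive_ge0_le (fun x => - F x) (fun x => - f x)) => //.
by move=> x /f0 /= ->; rewrite oppr0.
Qed.

Lemma derive_nearc F (f : R -> R) c d x C :
  (forall y, is_derive y 1 F (f y)) -> (forall y, y \in `]c, d[ -> F y = C) ->
  x \in `]c, d[ -> f x = 0.
Proof.
move=> dF FC xcd.
have H : is_derive x 1 F 0.
  apply: (@near_eq_is_derive _ _ _ (fun=> C)) => //.
  near=> y; rewrite FC//; near: y; exact: near_in_itvoo.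
by rewrite -(@derive_val _ _ _ _ _ _ _ (dF x)) derive_val.
Unshelve. all: by end_near. Qed.

(** A primitive of [g] is nondecreasing on [c, d] with equal values at both ends, hence constant,
    and its derivative vanishes at every point rather than almost everywhere. *)
Lemma integral_ge0_eq0 g c d x : continuous g ->
  (forall y, y \in `]c, d[ -> 0 <= g y) ->
  \int[leb]_(y in `[c, d]) g y = 0 -> x \in `]c, d[ -> g x = 0.
Proof.
move=> cg g0 ig xcd.
have cd : c < d by move: xcd; rewrite in_itv/= => /andP[]; exact: lt_trans.
have [G dG] := continuous_primitive cg.
move: ig; rewrite (ftc2 (ltW cd) cg dG) => /eqP; rewrite subr_eq0 => /eqP Gdc.
apply: (derive_nearc dG (C := G c)) xcd => y; rewrite in_itv/= => /andP[cy yd].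
apply/eqP; rewrite eq_le; apply/andP; split.
  rewrite -Gdc; apply: derive_ge0_le dG _; first exact: ltW.
  by move=> z; rewrite in_itv/= => /andP[yz zd]; rewrite g0// in_itv/= zd (lt_trans cy).
apply: derive_ge0_le dG _; first exact: ltW.
by move=> z; rewrite in_itv/= => /andP[yz zd]; rewrite g0// in_itv/= yz (lt_trans zd).
Qed.

Lemma continuous_const_closure H a b C : a < b -> continuous H ->
  (forall x, x \in `]a, b[ -> H x = C) -> forall x, x \in `[a, b] -> H x = C.
Proof.
move=> ab cH HC.
have Ha : H a = C.
  apply/eqP/negPn/negP => neq.
  have : \forall y \near a^'+, H y != C.
    have nb : nbhs (H a) [set y | y != C].
      by apply: open_nbhs_nbhs; split => //; exact: open_neq.
    exact: (cvg_at_right_filter (cH a) nb).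
  move=> nn.
  have : \forall y \near a^'+, H y = C.
    by near=> y; apply: HC; rewrite in_itv/=; apply/andP; split; near: y;
      [exact: nbhs_right_gt|exact: nbhs_right_lt].
  move=> nn2; near a^'+ => y.
  have /eqP : H y != C by near: y.
  by apply; near: y.
have Hb : H b = C.
  apply/eqP/negPn/negP => neq.
  have : \forall y \near b^'-, H y != C.
    have nb : nbhs (H b) [set y | y != C].
      by apply: open_nbhs_nbhs; split => //; exact: open_neq.
    exact: (cvg_at_left_filter (cH b) nb).
  move=> nn.
  have : \forall y \near b^'-, H y = C.
    by near=> y; apply: HC; rewrite in_itv/=; apply/andP; split; near: y;
      [exact: nbhs_left_gt|exact: nbhs_left_lt].
  move=> nn2; near b^'- => y.
  have /eqP : H y != C by near: y.
  by apply; near: y.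
move=> x; rewrite in_itv/= => /andP[].
rewrite le_eqVlt => /predU1P[<-//|ax]; rewrite le_eqVlt => /predU1P[->//|xb].
by apply: HC; rewrite in_itv/= ax.
Unshelve. all: by end_near. Qed.

Definition tent (e x : R) := Num.max 0 (e - `|x|).

Lemma continuous_tent e : continuous (tent e).
Proof.
move=> x; apply: (@continuous_max _ _ (fun=> 0) (fun x => e - `|x|)).
  exact: cvg_cst.
by apply: cvgB; [exact: cvg_cst|apply: cvg_norm; exact: cvg_id].
Qed.

Lemma tent_ge0 e x : 0 <= tent e x.
Proof. by rewrite le_max lexx. Qed.

Lemma tent_out e x : e <= `|x| -> tent e x = 0.
Proof. by move=> ex; rewrite /tent (max_idPl _)// subr_le0. Qed.

(** [psi] is the difference of two translates of a primitive of [tent e]. That primitive is constant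
    on each side of [-e, e], so the translates cancel both to the left and to the right of the two
    supports. *)
Lemma tent_test_function a b e x1 x2 : 0 < e ->
  a < x1 - e -> a < x2 - e -> x1 + e < b -> x2 + e < b ->
  exists2 psi, test_function a b psi &
    forall x, derive1 psi x = tent e (x - x1) - tent e (x - x2).
Proof.
move=> e0 a1 a2 b1 b2.
have [P dP] := continuous_primitive (@continuous_tent e).
have dPx z x : is_derive x 1 (fun x => P (x - z)) (tent e (x - z)).
  have H : is_derive x 1 (fun y : R => y - z) (1 - 0) :=
    is_deriveBx (is_derive_id x 1) (is_derive_cst z x 1).
  have dc := @is_derive1_comp _ P (fun y => y - z) x _ _ (dP (x - z)) H.
  by apply: is_derive_eq dc _; rewrite subr0 mulr1.
have dpsi x : is_derive x 1 (fun x => P (x - x1) - P (x - x2))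
    (tent e (x - x1) - tent e (x - x2)) by exact: is_deriveBx.
have dpsiE : derive1 (fun x => P (x - x1) - P (x - x2)) =
    (fun x => tent e (x - x1) - tent e (x - x2)).
  by apply/funext => x; rewrite derive1E derive_val.
have PL x : x <= - e -> P x = P (- e).
  move=> xe; apply: derive0_eq dP _ => // y; rewrite in_itv/= => /andP[_ ye].
  by rewrite tent_out// ler0_norm; lra.
have PR x : e <= x -> P x = P e.
  move=> xe; apply/esym; apply: derive0_eq dP _ => // y.
  rewrite in_itv/= => /andP[ey _].
  by rewrite tent_out// ger0_norm; lra.
exists (fun x => P (x - x1) - P (x - x2)); last by move=> x; rewrite dpsiE.
split.
- by move=> x; exact: ex_derive.
- rewrite dpsiE => x; apply: cvgB.
    apply: (@continuous_comp _ _ _ (fun x => x - x1) (tent e)).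
      by apply: cvgB; [exact: cvg_id|exact: cvg_cst].
    exact: continuous_tent.
  apply: (@continuous_comp _ _ _ (fun x => x - x2) (tent e)).
    by apply: cvgB; [exact: cvg_id|exact: cvg_cst].
  exact: continuous_tent.
- exists (Num.min (x1 - e) (x2 - e)), (Num.max (x1 + e) (x2 + e)); split.
  + by rewrite lt_min a1.
  + by rewrite gt_max b1.
  + move=> x; rewrite in_itv/= negb_and -!ltNge => /orP[].
      rewrite lt_min => /andP[? ?]; rewrite [P (x - x1)]PL ?[P (x - x2)]PL ?subrr//; lra.
    rewrite gt_max => /andP[? ?]; rewrite [P (x - x1)]PR ?[P (x - x2)]PR ?subrr//; lra.
Qed.

(** If H x1 < C < H x2, let psi' be a narrow tent at [x1] minus one at [x2]. Both [H] and the
    constant [C] are orthogonal to psi', so (C - H) psi' has integral 0, although it is nonnegative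
    and positive at [x1]. *)
Lemma du_bois_reymond a b H : a < b -> continuous H ->
  (forall psi, test_function a b psi ->
    \int[leb]_(x in `[a, b]) (H x * derive1 psi x) = 0) ->
  exists C, forall x, x \in `[a, b] -> H x = C.
Proof.
move=> ab cH H0.
have lt x1 x2 : x1 \in `]a, b[ -> x2 \in `]a, b[ -> ~ (H x1 < H x2).
  rewrite !in_itv/= => /andP[ax1 x1b] /andP[ax2 x2b] H12.
  pose C := (H x1 + H x2) / 2.
  have H1 : H x1 < C by rewrite /C; lra.
  have H2 : C < H x2 by rewrite /C; lra.
  have /nbhs_ballP[e1 /= e10 B1] : \forall y \near x1, H y < C.
    exact: (cH x1 _ (lt_nbhsl H1)).
  have /nbhs_ballP[e2 /= e20 B2] : \forall y \near x2, C < H y.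
    exact: (cH x2 _ (lt_nbhsr H2)).
  near (0 : R)^'+ => e.
  have e0 : 0 < e by [].
  have ee1 : e < e1 by near: e; exact: nbhs_right_lt.
  have ee2 : e < e2 by near: e; exact: nbhs_right_lt.
  have [||||psi tpsi dpsi] := @tent_test_function a b e x1 x2 e0.
  - suff : e < x1 - a by lra.
    by near: e; apply: nbhs_right_lt; lra.
  - suff : e < x2 - a by lra.
    by near: e; apply: nbhs_right_lt; lra.
  - suff : e < b - x1 by lra.
    by near: e; apply: nbhs_right_lt; lra.
  - suff : e < b - x2 by lra.
    by near: e; apply: nbhs_right_lt; lra.
  have [d1 cpsi [u [v [au vb psi0]]]] := tpsi.
  pose g x := (C - H x) * derive1 psi x.
  have cg : continuous g.
    move=> x; apply: cvgM; last exact: cpsi.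
    by apply: cvgB; [exact: cvg_cst|exact: cH].
  have g0 y : 0 <= g y.
    rewrite /g dpsi mulrBr subr_ge0 (@le_trans _ _ 0)//.
      have [ey|ye] := leP e `|y - x2|; first by rewrite tent_out// mulr0.
      rewrite mulr_le0_ge0 ?tent_ge0// subr_le0 ltW// B2//.
      by rewrite /ball/= distrC (lt_trans ye).
    have [ey|ye] := leP e `|y - x1|; first by rewrite tent_out// mulr0.
    rewrite mulr_ge0 ?tent_ge0// subr_ge0 ltW// B1//.
    by rewrite /ball/= distrC (lt_trans ye).
  have ig : \int[leb]_(y in `[a, b]) g y = 0.
    rewrite /g; under eq_Rintegral do rewrite mulrBl.
    rewrite RintegralB//; last 2 first.
    - by apply: continuous_itv_integrable => x; apply: cvgM; [exact: cvg_cst|exact: cpsi].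
    - by apply: continuous_itv_integrable => x; apply: cvgM; [exact: cH|exact: cpsi].
    rewrite H0// subr0 RintegralZl//; last exact: continuous_itv_integrable.
    have -> : \int[leb]_(x in `[a, b]) derive1 psi x = psi b - psi a.
      apply: ftc2 => [|//|x]; first exact: ltW.
      by rewrite derive1E; apply/derivableP.
    by rewrite !psi0 ?subrr ?mulr0// in_itv/= negb_and -!ltNge ?au ?vb ?orbT.
  have := integral_ge0_eq0 cg (fun y _ => g0 y) ig (x := x1).
  rewrite in_itv/= ax1 x1b => /(_ isT)/eqP.
  rewrite /g dpsi subrr (@tent_out _ (x1 - x2)).
    rewrite subr0 /tent normr0 subr0 (max_idPr (ltW e0)).
    by rewrite gt_eqF// mulr_gt0// subr_gt0.
  (* The tent at [x2] cannot reach [x1], since [H] exceeds [C] on its support. *)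
  rewrite leNgt; apply/negP => lte.
  have : C < H x1 by apply: B2; rewrite /ball/= distrC (lt_trans lte).
  by rewrite ltNge (ltW H1).
exists (H ((a + b) / 2)); apply: continuous_const_closure => // x xab.
have mab : (a + b) / 2 \in `]a, b[ by exact: mid_in_itvoo.
by apply/eqP; rewrite eq_le !leNgt; apply/andP; split; apply/negP; exact: lt.
Unshelve. all: by end_near. Qed.

End MoreRealAnalysis.

(** * Regularity of the eigenfunctions *)

Section Density.
Context {R : realType}.
Local Notation leb := (@lebesgue_measure R).
Variables (a b : R) (mu : probability (measurableTypeR R) R) (r : R -> R).
Implicit Types (x y z c d : R) (f g h : R -> R).

Definition has_density : Prop :=
  forall A : set (measurableTypeR R), measurable A ->
    mu A = (\int[leb]_(x in A `&` `[a, b]) (r x)%:E)%E.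

Hypotheses (cr : continuous r) (r_gt0 : forall x, 0 < r x) (mur : has_density).

Lemma density_dominates : mu `<< leb.
Proof.
apply/null_content_dominatesP => A mA A0; rewrite mur//.
apply: null_set_integral => //; first exact: measurableI.
  apply/measurable_EFinP/measurable_funTS.
  exact: continuous_measurable_fun.
apply/eqP; rewrite eq_le measure_ge0 andbT -[leRHS]A0.
by apply: le_measure; rewrite ?inE//; exact: measurableI.
Qed.

(** After the change of variables it remains to identify the Radon-Nikodym derivative with [r]
    almost everywhere on [E]: both have integral [mu A] over every measurable subset [A] of [E]. *)
Lemma Rintegral_density (E : set R) (f : R -> R) :
  measurable E -> E `<=` `[a, b] ->
  mu.-integrable E (EFin \o f) ->
  \int[mu]_(x in E) f x = \int[leb]_(x in E) (f x * r x).
Proof.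
move=> mE Eab fi.
rewrite /Rintegral; congr fine.
rewrite -(Radon_Nikodym_change_of_variables density_dominates)//=.
have mf := measurable_int _ fi.
have mr : measurable_fun E (fun x => (r x)%:E).
  by apply/measurable_EFinP/measurable_funTS; exact: continuous_measurable_fun.
apply: ae_eq_integral => //.
- apply: emeasurable_funM => //; apply: (measurable_int leb).
  apply: (integrableS _ _ (@subsetT _ _)) => //=.
  by apply: Radon_Nikodym_integrable; exact: density_dominates.
- by under eq_fun do rewrite EFinM; exact: emeasurable_funM.
- under [X in ae_eq _ _ _ X]eq_fun do rewrite EFinM.
  apply: ae_eqe_mul2l => /=.
  rewrite Radon_NikodymE//=; first exact: density_dominates.
  move=> abmu; case: cid => /= h [h1 h2 h3].
  apply: integral_ae_eq => //=; first exact: integrableS h2.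
  move=> A AE mA; rewrite -h3// mur//; congr (integral _ _ _).
  by apply/setIidl => x /AE/Eab.
Qed.

Lemma bounded_integrable (E : set R) (f : R -> R) : measurable E ->
  measurable_fun E f -> (exists M : R, forall x, E x -> `|f x| <= M) ->
  mu.-integrable E (EFin \o f).
Proof.
move=> mE mf [M fM]; apply: measurable_bounded_integrable => //.
  by rewrite (le_lt_trans (probability_le1 mu mE))// ltry.
exists M; split; first exact: num_real.
by move=> N MN x Ex; exact: le_trans (fM x Ex) (ltW MN).
Qed.

Lemma continuous_bounded_itv (f : R -> R) c d : continuous f ->
  exists M : R, forall x, x \in `[c, d] -> `|f x| <= M.
Proof.
move=> cf.
have /compact_bounded[M [_ HM]] : compact (f @` `[c, d]).
  by apply: continuous_compact; [exact: continuous_subspaceT|exact: segment_compact].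
exists (M + 1) => x xcd; apply: (HM (M + 1)); first by rewrite ltrDl.
by exists x.
Qed.

Lemma continuous_integrable (f : R -> R) c d : continuous f ->
  mu.-integrable `[c, d] (EFin \o f).
Proof.
move=> cf; apply: bounded_integrable => //.
  by apply: measurable_funTS; exact: continuous_measurable_fun.
by have [M HM] := continuous_bounded_itv c d cf; exists M => x; exact: HM.
Qed.

(** This supplies the elements on which the weak eigenvalue equation is tested. The boundary terms
    vanish because a test function is zero at [a] and [b]. *)
Lemma C1_H1 g (d : R -> R) : a < b -> continuous d ->
  (forall x : R, is_derive x 1 g (d x)) -> H1 a b mu g d.
Proof.
move=> ab cd dg; have cg := is_derive_continuous dg.
have cL2 h : continuous h -> L2 a b mu h.
  move=> ch; split.
    by apply: measurable_funTS; exact: continuous_measurable_fun.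
  exact: (@continuous_integrable (fun x => h x ^+ 2)) (continuous_sqr ch).
split; [exact: continuous_subspaceT|exact: cL2|exact: cL2|].
move=> psi [dpsi cpsi [u [v [au vb psi0]]]].
have Dpsi x : is_derive x 1 psi (derive1 psi x) by rewrite derive1E; apply/derivableP.
rewrite (by_parts (ltW ab) cd cpsi dg Dpsi).
by rewrite !psi0 ?mulr0 ?subrr ?sub0r// in_itv/= negb_and -!ltNge ?au ?vb ?orbT.
Qed.

(** The product is dominated by f^2 + g^2. *)
Lemma L2_mul_integrable (f g : R -> R) : L2 a b mu f -> continuous g ->
  mu.-integrable `[a, b] (EFin \o (fun x => f x * g x)).
Proof.
move=> [mf f2] cg.
have mg : measurable_fun (`[a, b] : set (measurableTypeR R)) g.
  by apply: measurable_funTS; exact: continuous_measurable_fun.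
have i2 : mu.-integrable `[a, b] (EFin \o (fun x => f x ^+ 2 + g x ^+ 2)).
  apply: (@integrableD _ _ _ mu _ _ (fun x => (f x ^+ 2)%:E) (fun x => (g x ^+ 2)%:E)) => //.
  exact: (@continuous_integrable (fun x => g x ^+ 2)) (continuous_sqr cg).
apply: le_integrable i2 => //.
  by apply/measurable_EFinP; exact: measurable_funM.
move=> x _ /=; rewrite lee_fin normrM.
rewrite [leRHS]ger0_norm ?addr_ge0 ?sqr_ge0//.
rewrite -(real_normK (num_real (f x))) -(real_normK (num_real (g x))).
have := sqr_ge0 (`|f x| - `|g x|).
have := sqr_ge0 (`|f x| + `|g x|).
set u := `|f x|; set v := `|g x|; nra.
Qed.

Section EigenfunctionRegularity.
Hypothesis ab : a < b.

(* p is the flux rho e'. *)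
Definition regular_eigenpair (l : R) (e p : R -> R) : Prop :=
  [/\ forall x : R, is_derive x 1 e (p x / r x),
      forall x : R, is_derive x 1 p (- (l * (e (clamp a b x) * r x))),
      p a = 0 & p b = 0].

(* Testing the eigenvalue equation on the primitives of psi / rho, for test
   functions psi, shows that f + \int Phi / rho is constant, where
   Phi' = l f rho: this bypasses the density of test functions in L^2. *)
Lemma eigenfunction_regular l f : poincare_eigen a b mu l f ->
  exists e p, regular_eigenpair l e p /\ forall x, x \in `[a, b] -> f x = e x.
Proof.
move=> [df [[cwf fL2 dfL2 wf] eig]].
pose ft := f \o clamp a b.
have cft : continuous ft by exact: continuous_comp_clamp (ltW ab) cwf.
have ftE x : x \in `[a, b] -> ft x = f x by move=> xab; rewrite /ft/= clamp_id.
have dotE g : continuous g ->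
    dotL2 a b mu f g = \int[leb]_(x in `[a, b]) (ft x * r x * g x).
  move=> cg; rewrite /dotL2 Rintegral_density//; last exact: L2_mul_integrable.
  by apply: eq_Rintegral => x; rewrite inE => xab; rewrite ftE// mulrAC.
have cfr : continuous (fun x => l * (ft x * r x)).
  move=> x; apply: cvgM; first exact: cvg_cst.
  by apply: cvgM; [exact: cft|exact: cr].
have [P0 dP0] := continuous_primitive cfr.
pose P x := P0 x - P0 a.
have dP x : is_derive x 1 P (l * (ft x * r x)).
  apply: is_derive_eq (is_deriveBx (dP0 x) (is_derive_cst (P0 a) x 1)) _.
  by rewrite subr0.
have cP := is_derive_continuous dP.
have Pa : P a = 0 by rewrite /P subrr.
have c1 : continuous (fun _ : R => 1 : R) by move=> x; exact: cvg_cst.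
have c0 : continuous (fun _ : R => 0 : R) by move=> x; exact: cvg_cst.
have ldot g : continuous g -> l * dotL2 a b mu f g =
    \int[leb]_(x in `[a, b]) (l * (ft x * r x) * g x).
  move=> cg; rewrite dotE// -RintegralZl//; last first.
    apply: continuous_itv_integrable => x; apply: cvgM; last exact: cg.
    by apply: cvgM; [exact: cft|exact: cr].
  by apply: eq_Rintegral => x _; rewrite !mulrA.
(* Testing on the constant 1 gives the natural boundary condition at [b]; the one at [a] holds by
   the choice of the primitive. *)
have Pb : P b = 0.
  have d1 x : is_derive x 1 (fun _ : R => 1 : R) (0 : R) by exact: is_derive_cst.
  have := eig _ _ (C1_H1 ab c0 d1).
  rewrite ldot//; under [in RHS]eq_Rintegral do rewrite mulr1.
  rewrite (ftc2 (ltW ab) cfr dP) Pa subr0 => <-.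
  rewrite /dotL2; under eq_Rintegral do rewrite mulr0.
  by rewrite Rintegral_cst//= mul0r.
have cPr : continuous (fun x => P x / r x).
  by move=> x; apply: cvgM; [exact: cP|apply: cvgV; [rewrite gt_eqF|exact: cr]].
have [G dG] := continuous_primitive cPr.
have cG := is_derive_continuous dG.
have [|psi tpsi|C HC] := @du_bois_reymond R a b (fun x => ft x + G x) ab.
- by move=> x; apply: cvgD; [exact: cft|exact: cG].
- have [dpsi cpsi [u [v [au vb psi0]]]] := tpsi.
  have Dpsi x : is_derive x 1 psi (derive1 psi x) by rewrite derive1E; apply/derivableP.
  have psic := is_derive_continuous Dpsi.
  have psia : psi a = 0 by rewrite psi0// in_itv/= negb_and -!ltNge au.
  have psib : psi b = 0 by rewrite psi0// in_itv/= negb_and -!ltNge vb orbT.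
  have cd : continuous (fun x => psi x / r x).
    by move=> x; apply: cvgM; [exact: psic|apply: cvgV; [rewrite gt_eqF|exact: cr]].
  have [g dg] := continuous_primitive cd.
  have cg := is_derive_continuous dg.
  have gP : \int[leb]_(x in `[a, b]) (l * (ft x * r x) * g x) =
      - \int[leb]_(x in `[a, b]) (psi x / r x * P x).
    under eq_Rintegral do rewrite mulrC.
    by rewrite (by_parts (ltW ab) cd cfr dg dP) Pa Pb !mulr0 subr0 sub0r.
  have := eig _ _ (C1_H1 ab cd dg); rewrite ldot// gP.
  rewrite /dotL2 Rintegral_density//; last exact: L2_mul_integrable.
  under eq_Rintegral do rewrite -mulrA divfK ?gt_eqF//.
  move=> H1.
  have H2 : \int[leb]_(x in `[a, b]) (ft x * derive1 psi x) =
      \int[leb]_(x in `[a, b]) (psi x / r x * P x).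
    rewrite -[RHS]opprK -H1 -wf//.
    by apply: eq_Rintegral => x; rewrite inE => xab; rewrite ftE.
  under eq_Rintegral do rewrite mulrDl.
  rewrite RintegralD//; last 2 first.
  + by apply: continuous_itv_integrable => x; apply: cvgM; [exact: cft|exact: cpsi].
  + by apply: continuous_itv_integrable => x; apply: cvgM; [exact: cG|exact: cpsi].
  rewrite H2 (by_parts (ltW ab) cPr cpsi dG Dpsi) psia psib !mulr0 subr0 sub0r.
  apply/eqP; rewrite subr_eq0; apply/eqP; apply: eq_Rintegral => x _.
  by rewrite mulrAC [psi x * _]mulrC mulrAC.
(* The derivative of C - G is - P / r, so the flux is - P. These formulas make sense on the whole
   line, whereas [f] is controlled on [a, b] only. *)
exists (fun x => C - G x), (fun x => - P x).
have fe x : x \in `[a, b] -> f x = C - G x.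
  by move=> xab; rewrite -ftE// -(HC x xab) addrK.
split; last exact: fe.
split; rewrite ?Pa ?Pb ?oppr0// => x.
  apply: is_derive_eq (is_deriveBx (is_derive_cst C x 1) (dG x)) _.
  by rewrite sub0r mulNr.
apply: is_derive_eq (is_deriveNx (dP x)) _.
by rewrite -fe// clamp_itv// ltW.
Qed.

End EigenfunctionRegularity.
End Density.

(** Extending the density by its boundary values keeps it continuous and positive, and leaves [mu]
    unchanged because only [a, b] is integrated over. *)
Lemma bounded_perturbation_density (R : realType) (a b : R)
    (mu : probability (measurableTypeR R) R) : a < b ->
  bounded_perturbation_of_uniform a b mu ->
  exists r : R -> R, [/\ continuous r, forall x, 0 < r x & has_density a b mu r].
Proof.
move=> ab [rho [murho rho0 crho _]]; exists (rho \o clamp a b); split.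
- exact: continuous_comp_clamp (ltW ab) crho.
- by move=> x /=; apply/rho0/clamp_itv/ltW.
- move=> A mA; rewrite murho//; apply: eq_integral => x; rewrite inE => -[_ xab].
  by rewrite /= clamp_id.
Qed.

(** * Zeros of combinations of eigenfunctions *)

Section Sturm.
Context {R : realType}.
Variables (a b : R) (r : R -> R).
Hypotheses (ab : a < b) (cr : continuous r) (r_gt0 : forall x, 0 < r x).
Implicit Types (x y z l : R) (e p u v q : R -> R).

(* Gronwall: E = e^2 + p^2 satisfies |E'| <= C E. *)
Lemma regular_eigenpair_unique l e p z : regular_eigenpair a b r l e p ->
  z \in `[a, b] -> e z = 0 -> p z = 0 -> forall x, x \in `[a, b] -> e x = 0.
Proof.
move=> [de dp _ _] zab ez pz.
have [M1 HM1] : exists M : R, forall x, x \in `[a, b] -> `|(r x)^-1| <= M.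
  apply: (continuous_bounded_itv (f := fun x => (r x)^-1)) => x.
  by apply: cvgV; [rewrite gt_eqF|exact: cr].
have [M2 HM2] := continuous_bounded_itv a b cr.
pose C := M1 + `|l| * M2.
pose E x := e x ^+ 2 + p x ^+ 2.
pose E' x := 2 * (e x * (p x / r x) - p x * (l * (e (clamp a b x) * r x))).
have dE x : is_derive x 1 E (E' x).
  rewrite /E; under eq_fun do rewrite !expr2.
  apply: is_derive_eq (is_deriveDx (is_deriveMx (de x) (de x))
    (is_deriveMx (dp x) (dp x))) _.
  rewrite /E'; ring.
have bE x : x \in `[a, b] -> `|E' x| <= C * E x.
  move=> xab; rewrite /E' clamp_id//.
  have r1 := HM1 _ xab; have r2 := HM2 _ xab.
  (* E' = 2 e p (1 / r - l r): the first factor 2 e p is at most E in absolute value, the last one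
     at most [C]. *)
  have -> : e x * (p x / r x) - p x * (l * (e x * r x)) =
    (e x * p x) * ((r x)^-1 - l * r x) by ring.
  rewrite mulrA normrM.
  have h1 : `|2 * (e x * p x)| <= E x.
    rewrite ler_norml /E; apply/andP; split.
      by have := sqr_ge0 (e x + p x); nra.
    by have := sqr_ge0 (e x - p x); nra.
  have h2 : `|(r x)^-1 - l * r x| <= C.
    rewrite (le_trans (ler_normB _ _))// lerD//.
    by rewrite normrM ler_wpM2l.
  rewrite mulrC; exact: ler_pM.
have E0 x : 0 <= E x by rewrite addr_ge0 ?sqr_ge0.
have Ez : E z = 0 by rewrite /E ez pz !expr0n/= addr0.
have dexp k x : is_derive x 1 (fun y : R => expR (k * y)) (k * expR (k * x)).
  have h : is_derive x 1 (fun y : R => k * y) (k * 1) := is_deriveZx k (is_derive_id x 1).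
  have dc := @is_derive1_comp _ expR (fun y => k * y) x _ _ (is_derive_expR _) h.
  by apply: is_derive_eq dc _; rewrite mulr1 mulrC.
have dF k x : is_derive x 1 (fun y => E y * expR (k * y))
    ((E' x + k * E x) * expR (k * x)).
  apply: is_derive_eq (is_deriveMx (dE x) (dexp k x)) _; ring.
move=> x xab.
suff : E x <= 0.
  move=> Ex; have : E x == 0 by rewrite eq_le Ex E0.
  by rewrite paddr_eq0 ?sqr_ge0// => /andP[+ _]; rewrite sqrf_eq0 => /eqP.
move: (xab) (zab); rewrite !in_itv/= => /andP[ax xb] /andP[az zb].
(* To the left of [z], E exp(C x) is nondecreasing and reaches 0 at [z]. To the right, E exp(- C x)
   is nonincreasing and starts from 0. *)
have [xz|zx] := leP x z.
  have := derive_ge0_le xz (dF C); rewrite Ez mul0r.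
  suff H : forall y, y \in `]x, z[ -> 0 <= (E' y + C * E y) * expR (C * y).
    by move=> /(_ H); rewrite pmulr_lle0 ?expR_gt0.
  move=> y; rewrite in_itv/= => /andP[xy yz].
  rewrite mulr_ge0 ?expR_ge0// -lerBlDr sub0r.
  have yab : y \in `[a, b] by rewrite in_itv/= (le_trans ax (ltW xy)) (le_trans (ltW yz) zb).
  by have := bE _ yab; rewrite ler_norml => /andP[].
have dNF y := is_deriveNx (dF (- C) y).
have := derive_ge0_le (ltW zx) dNF; rewrite /= Ez mul0r oppr0.
suff H : forall y, y \in `]z, x[ -> 0 <= - ((E' y + (- C) * E y) * expR (- C * y)).
  by move=> /(_ H); rewrite oppr_ge0 pmulr_lle0 ?expR_gt0.
move=> y; rewrite in_itv/= => /andP[zy yx].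
rewrite -mulNr mulr_ge0 ?expR_ge0// opprD mulNr opprK addrC subr_ge0.
have yab : y \in `[a, b] by rewrite in_itv/= (le_trans az (ltW zy)) (le_trans (ltW yx) xb).
by have := bE _ yab; rewrite ler_norml => /andP[].
Qed.

(** A lower bound on the number of zeros, multiplicities ignored. The increasing enumeration
    provides the intervals for Rolle's theorem; values of [z] from index [K] on are irrelevant. *)
Definition has_zeros (K : nat) u : Prop := exists z : nat -> R,
  (forall i, (i.+1 < K)%N -> z i < z i.+1) /\
  forall i, (i < K)%N -> z i \in `[a, b] /\ u (z i) = 0.

Lemma rolle_zero u q c d : c < d -> (forall x, is_derive x 1 u (q x)) ->
  u c = 0 -> u d = 0 -> exists2 y, c < y < d & q y = 0.
Proof.
move=> cd du uc ud.
have cu := is_derive_continuous du.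
have [|||y ycd dy] := @Rolle R u c d cd; [by move=> x _; exact: ex_derive| |by rewrite uc ud|].
  exact: continuous_subspaceT.
exists y; first by rewrite in_itv/= in ycd.
by rewrite -(@derive_val _ _ _ _ _ _ _ (du y)) derive_val.
Qed.

(* The flux q vanishes at a, at b, and between consecutive zeros of u; hence
   its derivative vanishes between these K + 1 points. *)
Lemma has_zeros_operator K u q v :
  (forall x, is_derive x 1 u (q x / r x)) ->
  (forall x, is_derive x 1 q (- (v (clamp a b x) * r x))) ->
  q a = 0 -> q b = 0 -> has_zeros K u -> has_zeros K v.
Proof.
case: K => [|K]; first by move=> *; exists (fun=> 0).
move=> du dq qa qb [z [zlt z0]].
have /choice[y yP] : forall i, exists y, (i.+1 < K.+1)%N ->
    z i < y < z i.+1 /\ q y = 0.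
  move=> i.
  have [iK|iK] := ltnP i.+1 K.+1; last by exists 0.
  have [_ zi0] := z0 _ (ltnW iK); have [_ zi1] := z0 _ iK.
  have [y yi qy] := rolle_zero (zlt _ iK) du zi0 zi1.
  exists y => _; split => //.
  by move/eqP: qy; rewrite mulf_eq0 invr_eq0 (gt_eqF (r_gt0 y)) orbF => /eqP.
have zab i : (i < K.+1)%N -> a <= z i <= b by move=> /z0[]; rewrite in_itv.
(* After the case analysis there are K + 1 zeros, hence K points [y]. With [a] and [b] they form K +
   2 increasing zeros of [q], which enclose K + 1 zeros of [v]. *)
pose w i := if i is j.+1 then (if j == K then b else y j) else a.
have wlt i : (i < K.+1)%N -> w i < w i.+1.
  case: i => [_|i iK] /=.
    have [//|K0] := eqVneq 0%N K.
    have K1 : (1 < K.+1)%N by rewrite ltnS lt0n eq_sym.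
    have [/andP[zy _] _] := yP _ K1; have /andP[az _] := zab 0%N isT.
    exact: le_lt_trans zy.
  rewrite ltnS in iK; rewrite (ltn_eqF iK).
  have [/andP[_ yz] _] := yP i iK.
  have [iKe|iKn] := eqVneq i.+1 K.
    by have /andP[_ zb] := zab _ (iK : i.+1 < K.+1)%N; exact: lt_le_trans zb.
  have iK1 : (i.+2 < K.+1)%N by rewrite ltnS ltn_neqAle iKn.
  by have [/andP[zy _] _] := yP _ iK1; exact: lt_trans zy.
have w0 i : (i <= K.+1)%N -> q (w i) = 0.
  case: i => [//|i]; rewrite ltnS => iK /=; have [//|iKn] := eqVneq i K.
  by have [] := yP i; rewrite ?ltnS ?ltn_neqAle ?iKn.
have wab i : (i <= K.+1)%N -> a <= w i <= b.
  case: i => [|i]; first by rewrite lexx ltW.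
  rewrite ltnS => iK /=; have [|iKn] := eqVneq i K; first by rewrite lexx ltW.
  have iK' : (i.+1 < K.+1)%N by rewrite ltnS ltn_neqAle iKn.
  have [/andP[zy yz] _] := yP _ iK'.
  have /andP[az _] := zab _ (ltnW iK'); have /andP[_ zb] := zab _ iK'.
  by rewrite (le_trans az (ltW zy)) (le_trans (ltW yz) zb).
have /choice[s sP] : forall i, exists s, (i < K.+1)%N ->
    w i < s < w i.+1 /\ v s = 0.
  move=> i.
  have [iK|iK] := ltnP i K.+1; last by exists 0.
  have [s si vs] := rolle_zero (wlt _ iK) dq (w0 _ (ltnW iK)) (w0 _ iK).
  exists s => _; split => //.
  move: vs => /eqP; rewrite oppr_eq0 mulf_eq0 (gt_eqF (r_gt0 s)) orbF => /eqP.
  rewrite clamp_id// in_itv/=; move: si => /andP[ws sw].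
  have /andP[aw _] := wab _ (ltnW iK); have /andP[_ wb] := wab _ iK.
  by rewrite (le_trans aw (ltW ws)) (le_trans (ltW sw) wb).
exists s; split => i iK.
  have [/andP[_ sw] _] := sP _ (ltnW iK); have [/andP[ws _] _] := sP _ iK.
  exact: lt_trans ws.
have [/andP[ws sw] vs] := sP _ iK; split => //; rewrite in_itv/=.
have /andP[aw _] := wab _ (ltnW iK); have /andP[_ wb] := wab _ iK.
by rewrite (le_trans aw (ltW ws)) (le_trans (ltW sw) wb).
Qed.

(* Two zeros of u_k merging into z would enclose a zero of q_k, so that z would
   be a zero of both U and Q. *)
Lemma has_zeros_limit K (u q : nat -> R -> R) (U Q : R -> R) (eps : nat -> R) :
  (forall k x, is_derive x 1 (u k) (q k x / r x)) ->
  continuous U -> continuous Q ->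
  (forall k x, x \in `[a, b] -> `|u k x - U x| <= eps k) ->
  (forall k x, x \in `[a, b] -> `|q k x - Q x| <= eps k) ->
  eps @ \oo --> 0 ->
  (forall x, x \in `[a, b] -> U x = 0 -> Q x <> 0) ->
  (forall k, has_zeros K (u k)) -> has_zeros K U.
Proof.
case: K => [|K']; first by move=> *; exists (fun=> 0).
set K := K'.+1; move=> du cU cQ uU qQ eps0 UQ /choice[z zP].
(* The vectors of zeros have a cluster point in the compact cube [a, b]^K; [close] then plays the
   part of a convergent subsequence. *)
pose V k : 'rV[R]_K := \row_i z k i.
have cS := @rV_compact R K (fun=> `[a, b]%classic) (fun=> @segment_compact R a b).
have [|v0 [/= vab clv]] := cS (V @ \oo) _.
  by exists 0%N => // k _ i /=; rewrite mxE; have [_ /(_ i (ltn_ord i))[]] := zP k.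
pose v (i : 'I_K) : R := v0 0 i.
have close (d : R) (n : nat) : 0 < d -> exists2 k, (n <= k)%N & forall i, `|v i - z k i| < d.
  move=> d0.
  have [_ [[k /= nk <-] vk]] := clv (V @` [set k | (n <= k)%N]) (ball v0 d)
    (ex_intro2 _ _ n I (fun k nk => ex_intro2 _ _ k nk erefl)) (nbhsx_ballx v0 d d0).
  by exists k => // i; have [_ /(_ 0 i)] := vk; rewrite mxE.
(* At a zero y of [f k] near x, |F x| <= |F x - F y| + eps k, and both terms are small. This is used
   for [U] and again for [Q]. *)
have lim0 (f : nat -> R -> R) (F : R -> R) x : continuous F ->
    (forall k x, x \in `[a, b] -> `|f k x - F x| <= eps k) ->
    (forall (d : R) n, 0 < d -> exists2 k, (n <= k)%N &
       exists y, [/\ y \in `[a, b], `|x - y| < d & f k y = 0]) -> F x = 0.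
  move=> cF fF near0; apply/eqP/negPn/negP => Fx0.
  have h0 : 0 < `|F x| / 2 by rewrite divr_gt0// normr_gt0.
  have /cvgrPdist_lt/(_ _ h0)/nbhs_ballP[d1 /= d10 Fd] := cF x.
  have /cvgrPdist_lt/(_ _ h0)[n _ en] := eps0.
  have [k nk [y [yab xy fy]]] := near0 d1 n d10.
  have := en _ nk; rewrite sub0r normrN => /(le_lt_trans (ler_norm _)) ek.
  have := Fd _ xy => /= F1.
  have := fF k y yab; rewrite fy sub0r normrN => F2.
  have := ler_normD (F x - F y) (F y); rewrite subrK => F3.
  lra.
have vi0 i : U (v i) = 0.
  apply: (lim0 u) => // d n d0; have [k nk vk] := close d n d0.
  by exists k => //; exists (z k i); have [_ /(_ i (ltn_ord i))[]] := zP k.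
have vlt (i j : 'I_K) : j = i.+1 :> nat -> v i < v j.
  move=> ij; have zij k : z k i < z k j.
    by have [H _] := zP k; rewrite ij; apply: H; rewrite -ij.
  clear ij.
  rewrite lt_neqAle; apply/andP; split; last first.
    rewrite leNgt; apply/negP => vji.
    have [|k _ vk] := close ((v i - v j) / 2) 0%N; first by rewrite divr_gt0// subr_gt0.
    have := vk i; have := vk j; have := zij k; rewrite !ltr_norml => h1 /andP[h2 h3] /andP[h4 h5].
    lra.
  apply/negP => /eqP vij; apply: (UQ (v i)) => //.
  apply: (lim0 q) => // d n d0; have [k nk vk] := close d n d0.
  have [_ zk] := zP k.
  have [zia ui] := zk i (ltn_ord i); have [zja uj] := zk j (ltn_ord j).
  have [y /andP[iy yj] qy] := rolle_zero (zij k) (du k) ui uj.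
  exists k => //; exists y; split.
  - move: zia zja; rewrite !in_itv/= => /andP[? _] /andP[_ ?].
    by rewrite (le_trans _ (ltW iy))// (le_trans (ltW yj)).
  - have := vk i; have := vk j; rewrite -vij !ltr_norml => /andP[h2 h3] /andP[h4 h5].
    by apply/andP; split; lra.
  - by move/eqP: qy; rewrite mulf_eq0 invr_eq0 (gt_eqF (r_gt0 y)) orbF => /eqP.
exists (fun i => v (inord i : 'I_K'.+1)); split => i iK.
  by apply: vlt; rewrite !inordK// ltnW.
by split; [exact: vab|exact: vi0].
Qed.

End Sturm.

(** * Power iteration towards the top eigenfunction *)

Section TopEigenfunction.
Context {R : realType}.
Variables (a b : R) (r : R -> R).
Hypotheses (ab : a < b) (cr : continuous r) (r_gt0 : forall x, 0 < r x).
Variables (l : nat -> R) (e p : nat -> R -> R).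
Hypothesis ep : forall m, regular_eigenpair a b r (l m) (e m) (p m).
Hypotheses (l0 : l 0%N = 0) (l_lt : forall m, l m < l m.+1).

Lemma eigenvalue_lt i j : (i < j)%N -> l i < l j.
Proof. exact: (homo_ltn lt_trans l_lt). Qed.

Lemma eigenvalue_ge0 m : 0 <= l m.
Proof. by case: m => [|m]; [rewrite l0|rewrite -l0 ltW// eigenvalue_lt]. Qed.

Lemma has_zeros_top K N (c : nat -> R) : (0 < N)%N -> c N != 0 ->
  (exists2 x, x \in `[a, b] & e N x != 0) ->
  has_zeros a b K (fun x => \sum_(m < N.+1) c m * e m x) -> has_zeros a b K (e N).
Proof.
move=> N0 cN [x0 x0ab ex0] zK.
have lN : 0 < l N by rewrite -l0 eigenvalue_lt.
(* Here t N = 1 and 0 <= t m < 1 for m < N. The flux of [u k] is [q k], whose derivative on [a, b]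
   is - l N times [u k.+1] times [r]: one step of the iteration is one use of
   [has_zeros_operator]. *)
pose t m := l m / l N.
pose u k x := \sum_(m < N.+1) (c m * t m ^+ k) * e m x.
pose q k x := \sum_(m < N.+1) (c m * t m ^+ k) * p m x.
have du k (x : R) : is_derive x 1 (u k) (q k x / r x).
  rewrite /q mulr_suml.
  apply: (@is_derive_sumx R N.+1 (fun m x => (c m * t m ^+ k) * e m x)
    (fun m => (c m * t m ^+ k) * p m x / r x)) => m _.
  by rewrite -mulrA; apply: is_deriveZx; case: (ep m).
have dq k (x : R) : is_derive x 1 (q k) (- (l N * u k.+1 (clamp a b x) * r x)).
  have -> : - (l N * u k.+1 (clamp a b x) * r x) = \sum_(m < N.+1)
      (c m * t m ^+ k) * - (l m * (e m (clamp a b x) * r x)).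
    rewrite /u mulr_sumr mulr_suml -sumrN; apply: eq_bigr => m _.
    have tl : l N * t m = l m by rewrite /t mulrC divfK// gt_eqF.
    rewrite exprS -[in RHS]tl; ring.
  apply: (@is_derive_sumx R N.+1 (fun m x => (c m * t m ^+ k) * p m x)
    (fun m => (c m * t m ^+ k) * - (l m * (e m (clamp a b x) * r x)))) => m _.
  by apply: is_deriveZx; case: (ep m).
have uK k : has_zeros a b K (u k).
  elim: k => [|k IH].
    case: zK => z [zlt z0]; exists z; split => // i iK; have [zab <-] := z0 _ iK.
    by split => //; apply: eq_bigr => m _; rewrite expr0 mulr1.
  have qa : q k a = 0.
    by rewrite /q big1// => m _; have [_ _ -> _] := ep m; rewrite mulr0.
  have qb : q k b = 0.
    by rewrite /q big1// => m _; have [_ _ _ ->] := ep m; rewrite mulr0.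
  have [z [zlt z0]] := has_zeros_operator ab r_gt0 (v := fun x => l N * u k.+1 x)
    (du k) (dq k) qa qb IH.
  exists z; split => // i iK; have [zab /eqP] := z0 _ iK.
  by rewrite mulf_eq0 (gt_eqF lN)/= => /eqP.
have ce m : continuous (e m).
  by have [de _ _ _] := ep m; exact: is_derive_continuous de.
have cp m : continuous (p m).
  by have [_ dp _ _] := ep m; exact: is_derive_continuous dp.
have /choice[M HM] : forall m, exists M : R, forall x, x \in `[a, b] ->
    `|e m x| <= M /\ `|p m x| <= M.
  move=> m; have [M1 H1] := continuous_bounded_itv a b (ce m).
  have [M2 H2] := continuous_bounded_itv a b (cp m).
  exists (Num.max M1 M2) => x xab.
  by rewrite !le_max H1// H2// orbT.
(* Since [M m] bounds both [e m] and [p m], this one sequence controls the functions and their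
   fluxes, which gives convergence in C^1. *)
pose eps k := \sum_(m < N) `|c m| * t m ^+ k * M m.
have t_ge0 m : 0 <= t m by rewrite divr_ge0// ?eigenvalue_ge0// ltW.
have bnd (h : nat -> R -> R) k x : (forall m, `|h m x| <= M m) ->
    `|\sum_(m < N.+1) (c m * t m ^+ k) * h m x - c N * h N x| <= eps k.
  move=> hM; rewrite big_ord_recr/= [t N]divff ?gt_eqF// expr1n mulr1 addrK.
  apply: (le_trans (ler_norm_sum _ _ _)); apply: ler_sum => m _.
  rewrite !normrM normrX (ger0_norm (t_ge0 _)) ler_wpM2l//.
  by rewrite mulr_ge0// exprn_ge0.
have eps0 : eps @ \oo --> 0.
  have -> : 0 = \sum_(m < N) `|c m| * 0 * M m :> R.
    by rewrite big1// => m _; rewrite mulr0 mul0r.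
  apply: cvg_big => [|m _]; first exact: add_continuous.
  apply: cvgM; last exact: cvg_cst.
  apply: cvgM; first exact: cvg_cst.
  apply: cvg_expr; rewrite ger0_norm// ltr_pdivrMr// mul1r.
  exact: eigenvalue_lt.
have [|||||z [zlt z0]] := @has_zeros_limit R a b r r_gt0 K u q
  (fun x => c N * e N x) (fun x => c N * p N x) eps du _ _ _ _ eps0 _ uK.
- by move=> x; apply: cvgM; [exact: cvg_cst|exact: ce].
- by move=> x; apply: cvgM; [exact: cvg_cst|exact: cp].
- by move=> k x xab; apply: bnd => m; have [] := HM m x xab.
- by move=> k x xab; apply: bnd => m; have [] := HM m x xab.
- move=> x xab /eqP; rewrite mulf_eq0 (negPf cN)/= => /eqP ex.
  move=> /eqP; rewrite mulf_eq0 (negPf cN)/= => /eqP px.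
  have := regular_eigenpair_unique cr r_gt0 (ep N) xab ex px x0ab.
  by move=> e0; rewrite e0 eqxx in ex0.
exists z; split => // i iK; have [zab /eqP] := z0 _ iK.
by rewrite mulf_eq0 (negPf cN)/= => /eqP.
Qed.

End TopEigenfunction.

(** * Courant's bound on the number of zeros *)

Section BoundedFunctions.
Context {R : realType}.
Variables (a b : R) (mu : probability (measurableTypeR R) R).
Implicit Types (f g h : R -> R) (x c : R).

(** An algebra of integrable functions that contains both the continuous functions and the
    eigenfunctions cut at nodes, whose cut derivatives may jump. *)
Definition bounded_measurable h : Prop :=
  measurable_fun [set: measurableTypeR R] h /\
  exists M : R, forall x, x \in `[a, b] -> `|h x| <= M.

Lemma bounded_measurable_continuous h : continuous h -> bounded_measurable h.
Proof.
move=> ch; split; first exact: continuous_measurable_fun.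
exact: continuous_bounded_itv.
Qed.

Lemma bounded_measurable_indic (i : interval R) :
  bounded_measurable (fun x => (x \in i)%:R).
Proof.
split.
  have -> : (fun x => (x \in i)%:R) = \1_[set` i] :> (R -> R).
    by apply/funext => x; rewrite indicE mem_setE.
  exact: measurable_indic.
by exists 1 => x _; case: (x \in i); rewrite ?normr0 ?normr1.
Qed.

Lemma bounded_measurableD f g : bounded_measurable f -> bounded_measurable g ->
  bounded_measurable (fun x => f x + g x).
Proof.
move=> [mf [M HM]] [mg [N HN]]; split; first exact: measurable_funD.
by exists (M + N) => x xab; rewrite (le_trans (ler_normD _ _))// lerD ?HM ?HN.
Qed.

Lemma bounded_measurableM f g : bounded_measurable f -> bounded_measurable g ->
  bounded_measurable (fun x => f x * g x).
Proof.
move=> [mf [M HM]] [mg [N HN]]; split; first exact: measurable_funM.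
by exists (M * N) => x xab; rewrite normrM ler_pM ?HM ?HN.
Qed.

Lemma bounded_measurableZ c f : bounded_measurable f ->
  bounded_measurable (fun x => c * f x).
Proof.
by apply: bounded_measurableM; apply: bounded_measurable_continuous => x; exact: cvg_cst.
Qed.

Lemma bounded_measurable_sum n (f : nat -> R -> R) :
  (forall i, bounded_measurable (f i)) ->
  bounded_measurable (fun x => \sum_(i < n) f i x).
Proof.
move=> mf; elim: n => [|n IH].
  under eq_fun do rewrite big_ord0.
  by apply: bounded_measurable_continuous => x; exact: cvg_cst.
by under eq_fun do rewrite big_ord_recr/=; exact: bounded_measurableD.
Qed.

Lemma bounded_measurable_integrable h : bounded_measurable h ->
  mu.-integrable `[a, b] (EFin \o h).
Proof.
move=> [mh [M HM]]; apply: bounded_integrable => //; first exact: measurable_funTS.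
by exists M.
Qed.

Local Notation E h := (Rintegral mu `[a, b]%classic h).

Lemma expectD f g : bounded_measurable f -> bounded_measurable g ->
  E (fun x => f x + g x) = E f + E g.
Proof. by move=> mf mg; rewrite RintegralD//; exact: bounded_measurable_integrable. Qed.

Lemma expectZ c f : bounded_measurable f -> E (fun x => c * f x) = c * E f.
Proof. by move=> mf; rewrite RintegralZl//; exact: bounded_measurable_integrable. Qed.

Lemma expect_sum n (f : nat -> R -> R) : (forall i, bounded_measurable (f i)) ->
  E (fun x => \sum_(i < n) f i x) = \sum_(i < n) E (f i).
Proof.
move=> mf; elim: n => [|n IH].
  rewrite big_ord0; under eq_Rintegral do rewrite big_ord0.
  by rewrite Rintegral_cst//= mul0r.
rewrite big_ord_recr/= -IH -expectD//; last exact: bounded_measurable_sum.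
by apply: eq_Rintegral => x _; rewrite big_ord_recr.
Qed.

Lemma expect_sqr_expand f g c : bounded_measurable f -> bounded_measurable g ->
  E (fun x => (f x - c * g x) ^+ 2) =
  E (fun x => f x ^+ 2) - 2 * c * E (fun x => f x * g x) + c ^+ 2 * E (fun x => g x ^+ 2).
Proof.
move=> mf mg.
have mf2 : bounded_measurable (fun x => f x ^+ 2).
  by under eq_fun do rewrite expr2; exact: bounded_measurableM.
have mg2 : bounded_measurable (fun x => g x ^+ 2).
  by under eq_fun do rewrite expr2; exact: bounded_measurableM.
have mfg : bounded_measurable (fun x => f x * g x) by exact: bounded_measurableM.
have mfgZ := bounded_measurableZ (- (2 * c)) mfg.
have mg2Z := bounded_measurableZ (c ^+ 2) mg2.
rewrite -(expectZ (c ^+ 2) mg2) -mulNr -(expectZ (- (2 * c)) mfg).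
rewrite -(expectD mf2 mfgZ) -(expectD (bounded_measurableD mf2 mfgZ) mg2Z).
by apply: eq_Rintegral => x _; ring.
Qed.

(** The [psi m] are orthogonal with squared norms [lam m], so the identity serves both the
    eigenfunctions and their derivatives. Inner products are given as [lam m * beta m] to avoid
    dividing by the zero eigenvalue. *)
Lemma bessel_identity g (psi : nat -> R -> R) (lam beta : nat -> R) n :
  bounded_measurable g -> (forall m, bounded_measurable (psi m)) ->
  (forall i j, E (fun x => psi i x * psi j x) = lam i * (i == j)%:R) ->
  (forall m, E (fun x => g x * psi m x) = lam m * beta m) ->
  E (fun x => (g x - \sum_(m < n) beta m * psi m x) ^+ 2) =
  E (fun x => g x ^+ 2) - \sum_(m < n) lam m * beta m ^+ 2.
Proof.
move=> mg mpsi psipsi gpsi; elim: n => [|n IH].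
  by rewrite big_ord0 subr0; apply: eq_Rintegral => x _; rewrite big_ord0 subr0.
pose S x := \sum_(m < n) beta m * psi m x.
have mS : bounded_measurable S.
  by apply: (@bounded_measurable_sum n (fun m x => beta m * psi m x)) => m;
    exact: bounded_measurableZ.
have mgS : bounded_measurable (fun x => g x - S x).
  under eq_fun do rewrite -mulN1r; apply: bounded_measurableD => //.
  exact: bounded_measurableZ.
have -> : E (fun x => (g x - \sum_(m < n.+1) beta m * psi m x) ^+ 2) =
    E (fun x => ((g x - S x) - beta n * psi n x) ^+ 2).
  by apply: eq_Rintegral => x _; rewrite big_ord_recr/= opprD addrA.
rewrite expect_sqr_expand// IH.
have -> : E (fun x => psi n x ^+ 2) = lam n.
  by under eq_Rintegral do rewrite expr2; rewrite psipsi eqxx mulr1.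
have -> : E (fun x => (g x - S x) * psi n x) = lam n * beta n.
  have -> : E (fun x => (g x - S x) * psi n x) =
    E (fun x => g x * psi n x + (- 1) * (\sum_(m < n) beta m * (psi m x * psi n x))).
    apply: eq_Rintegral => x _; rewrite mulrBl mulN1r; congr (_ - _).
    by rewrite mulr_suml; apply: eq_bigr => m _; rewrite mulrA.
  have mpp m : bounded_measurable (fun x => beta m * (psi m x * psi n x)).
    by apply/bounded_measurableZ/bounded_measurableM.
  have mSS := bounded_measurable_sum n mpp.
  rewrite expectD; [|exact: bounded_measurableM|exact: bounded_measurableZ].
  rewrite (expectZ _ mSS) (expect_sum n mpp) gpsi big1 ?mulr0 ?addr0// => m _.
  by rewrite expectZ ?psipsi ?(ltn_eqF (ltn_ord m)) ?mulr0//; exact: bounded_measurableM.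
by rewrite big_ord_recr/= expr2; ring.
Qed.

End BoundedFunctions.

(** * Energy on nodal intervals and the variational argument *)

Section Courant.
Context {R : realType}.
Variables (a b : R) (mu : probability (measurableTypeR R) R) (r : R -> R).
Hypotheses (ab : a < b) (cr : continuous r) (r_gt0 : forall x, 0 < r x).
Hypothesis mur : has_density a b mu r.
Variables (l : nat -> R) (e p : nat -> R -> R).
Hypothesis ep : forall m, regular_eigenpair a b r (l m) (e m) (p m).
Hypothesis l_lt : forall m, l m < l m.+1.
Local Notation E h := (Rintegral mu `[a, b]%classic h).
Hypothesis orth : forall i j, E (fun x => e i x * e j x) = (i == j)%:R.
Hypothesis total : forall f, bounded_measurable a b f ->
  (fun n => E (fun x => (f x - \sum_(m < n) E (fun y => f y * e m y) * e m x) ^+ 2))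
    @ \oo --> 0.

Let ce m : continuous (e m).
Proof. by have [de _ _ _] := ep m; exact: is_derive_continuous de. Qed.

Let cp m : continuous (p m).
Proof. by have [_ dp _ _] := ep m; exact: is_derive_continuous dp. Qed.

Let cd m : continuous (fun x => p m x / r x).
Proof. by move=> x; apply: cvgM; [exact: cp|apply: cvgV; [rewrite gt_eqF|exact: cr]]. Qed.

(** Half-open intervals make the indicators of adjacent pieces disjoint; adding the endpoint does
    not change the Lebesgue integral and prepares for integration by parts. *)
Lemma expect_indic_itv (c d : R) (h : R -> R) : a <= c -> d <= b -> continuous h ->
  E (fun x => (x \in `]c, d])%:R * h x) =
  \int[lebesgue_measure]_(x in `[c, d]) (h x * r x).
Proof.
move=> ac db ch.
have sub : `]c, d] `<=` `[a, b].
  move=> x /=; rewrite !in_itv/= => /andP[cx xd].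
  by rewrite (le_trans ac (ltW cx)) (le_trans xd db).
have -> : E (fun x => (x \in `]c, d])%:R * h x) = \int[mu]_(x in `]c, d]) h x.
  rewrite -[X in _ = Rintegral _ X _](setIidr sub) Rintegral_mkcondr.
  apply: eq_Rintegral => x _; rewrite patchE mem_setE.
  by case: ifP; rewrite ?mul1r ?mul0r.
rewrite (Rintegral_density cr mur)//; last first.
  have hi := bounded_measurable_integrable mu (bounded_measurable_continuous a b ch).
  exact: integrableS hi.
rewrite Rintegral_itv_obnd_cbnd//.
have chr : continuous (fun x => h x * r x).
  by move=> x; apply: cvgM; [exact: ch|exact: cr].
have hi := continuous_itv_integrable c d chr.
by apply: integrableS hi => //; exact: subset_itv_oc_cc.
Qed.

(** Integration by parts of [p m] against the derivative of [e k]. The hypotheses kill the boundary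
    terms: they hold at [a] and [b] because the flux vanishes, and at an interior zero of [e k]. *)
Lemma energy_itv m k c d : a <= c -> c <= d -> d <= b ->
  p m c * e k c = 0 -> p m d * e k d = 0 ->
  E (fun x => (x \in `]c, d])%:R * (p k x / r x * (p m x / r x))) =
  l m * E (fun x => (x \in `]c, d])%:R * (e k x * e m x)).
Proof.
move=> ac cd' db pc pd.
rewrite expect_indic_itv//; last by move=> x; apply: cvgM; exact: cd.
rewrite expect_indic_itv//; last by move=> x; apply: cvgM; exact: ce.
have [de _ _ _] := ep k; have [_ dp _ _] := ep m.
have cdp : continuous (fun x => - (l m * (e m (clamp a b x) * r x))).
  move=> x; apply: cvgN; apply: cvgM; first exact: cvg_cst.
  apply: cvgM; last exact: cr.
  by apply: continuous_comp; [exact: continuous_clamp|exact: ce].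
transitivity (\int[lebesgue_measure]_(x in `[c, d]) (p m x * (p k x / r x))).
  apply: eq_Rintegral => x _; have := r_gt0 x => rx; field; by rewrite gt_eqF.
rewrite (by_parts cd' cdp (@cd k) dp de) pc pd subrr sub0r -RintegralZl//; last first.
  apply: continuous_itv_integrable => x; apply: cvgM; last exact: cr.
  by apply: cvgM; exact: ce.
have cI : continuous (fun x => l m * (e k x * e m x * r x)).
  move=> x; apply: cvgM; first exact: cvg_cst.
  by apply: cvgM; [apply: cvgM; exact: ce|exact: cr].
transitivity (- \int[lebesgue_measure]_(x in `[c, d]) (- 1 * (l m * (e k x * e m x * r x)))).
  congr (- _); apply: eq_Rintegral => x; rewrite inE/= in_itv/= => /andP[cx xd].
  rewrite clamp_id ?in_itv/= ?(le_trans ac cx) ?(le_trans xd db)//; ring.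
have iI := continuous_itv_integrable c d cI.
by rewrite [in LHS]RintegralZl// mulN1r opprK.
Qed.

Lemma expect_whole (h : R -> R) : continuous h ->
  E h = E (fun x => (x \in `]a, b])%:R * h x).
Proof.
move=> ch; rewrite expect_indic_itv// (Rintegral_density cr mur)//.
exact/bounded_measurable_integrable/bounded_measurable_continuous.
Qed.

Lemma energy_orth i j :
  E (fun x => p i x / r x * (p j x / r x)) = l i * (i == j)%:R.
Proof.
have [_ _ pa pb] := ep j.
rewrite expect_whole; last by move=> x; apply: cvgM; exact: cd.
rewrite energy_itv ?pa ?pb ?mul0r ?lexx//; last exact: ltW.
rewrite -expect_whole; last by move=> x; apply: cvgM; exact: ce.
by rewrite orth; case: eqVneq => [->//|]; rewrite !mulr0.
Qed.

(** Otherwise [e N] would vanish on the open interval, and its flux too at the midpoint; uniqueness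
    would make [e N] zero on [a, b], against its unit norm. *)
Lemma expect_indic_sqr_gt0 N c d : a <= c -> c < d -> d <= b ->
  0 < E (fun x => (x \in `]c, d])%:R * e N x ^+ 2).
Proof.
move=> ac cd' db.
have ce2 := continuous_sqr (@ce N).
have cer : continuous (fun x => e N x ^+ 2 * r x).
  by move=> x; apply: cvgM; [exact: ce2|exact: cr].
rewrite expect_indic_itv// lt_neqAle Rintegral_ge0 ?andbT; last first.
  by move=> x _; rewrite mulr_ge0 ?sqr_ge0 ?ltW.
apply/negP => /eqP/esym e0.
have eN0 x : x \in `]c, d[ -> e N x = 0.
  move=> xcd; have /eqP := integral_ge0_eq0 cer
    (fun y _ => mulr_ge0 (sqr_ge0 (e N y)) (ltW (r_gt0 y))) e0 xcd.
  by rewrite mulf_eq0 (gt_eqF (r_gt0 x)) orbF sqrf_eq0 => /eqP.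
have mid : (c + d) / 2 \in `]c, d[ by exact: mid_in_itvoo.
have [de _ _ _] := ep N.
have pN0 : p N ((c + d) / 2) = 0.
  have /eqP := derive_nearc de eN0 mid.
  by rewrite mulf_eq0 invr_eq0 (gt_eqF (r_gt0 _)) orbF => /eqP.
have midab : (c + d) / 2 \in `[a, b].
  move: mid; rewrite !in_itv/= => /andP[h1 h2].
  by rewrite (le_trans ac (ltW h1)) (le_trans (ltW h2) db).
have eab := regular_eigenpair_unique cr r_gt0 (ep N) midab (eN0 _ mid) pN0.
have := orth N N; rewrite eqxx (@eq_Rintegral _ _ _ _ _ (fun=> 0)).
  by rewrite Rintegral_cst//= mul0r => /eqP; rewrite eq_sym oner_eq0.
by move=> x; rewrite inE => xab; rewrite eab// mul0r.
Qed.

Lemma bounded_measurable_eigen m : bounded_measurable a b (e m).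
Proof. by apply: bounded_measurable_continuous; exact: ce. Qed.

Lemma bounded_measurable_flux m : bounded_measurable a b (fun x => p m x / r x).
Proof. by apply: bounded_measurable_continuous; exact: cd. Qed.

(* Parseval for v and Bessel for dv give sum (l m - l N) beta_m^2 <= 0. *)
Lemma min_energy_eigen N (v dv : R -> R) (beta : nat -> R) :
  bounded_measurable a b v -> bounded_measurable a b dv ->
  (forall m, E (fun x => v x * e m x) = beta m) ->
  (forall m, E (fun x => dv x * (p m x / r x)) = l m * beta m) ->
  E (fun x => dv x ^+ 2) <= l N * E (fun x => v x ^+ 2) ->
  (forall m, (m < N)%N -> beta m = 0) ->
  E (fun x => (v x - beta N * e N x) ^+ 2) = 0.
Proof.
move=> mv mdv ve dve Ev beta0.
have l_mono i j : (i < j)%N -> l i < l j by exact: (homo_ltn lt_trans l_lt).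
pose B n := \sum_(m < n) beta m ^+ 2.
have parseval n : E (fun x => (v x - \sum_(m < n) beta m * e m x) ^+ 2) =
    E (fun x => v x ^+ 2) - B n.
  rewrite (bessel_identity n mv bounded_measurable_eigen (lam := fun=> 1) (beta := beta)).
  - by congr (_ - _); apply: eq_bigr => m _; rewrite mul1r.
  - by move=> i j; rewrite orth mul1r.
  - by move=> m; rewrite ve mul1r.
(* [dv] enters only through its coefficients against the derivatives of the [e m]; these stand in
   for membership of [v] in H^1. *)
have energy n : \sum_(m < n) l m * beta m ^+ 2 <= E (fun x => dv x ^+ 2).
  rewrite -subr_ge0 -(bessel_identity n mdv bounded_measurable_flux energy_orth dve).
  by apply: Rintegral_ge0 => x _; exact: sqr_ge0.
have lim : (fun n => E (fun x => v x ^+ 2) - B n) @ \oo --> 0.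
  have := total mv; apply: cvg_trans; apply: near_eq_cvg; near=> n.
  rewrite -parseval; apply: eq_Rintegral => x _.
  by congr ((_ - _) ^+ 2); apply: eq_bigr => m _; rewrite ve.
have beta_gt m0 : (N < m0)%N -> beta m0 = 0.
  move=> Nm0; apply/eqP/negPn/negP => bm0.
  pose gap := (l m0 - l N) * beta m0 ^+ 2.
  have gap0 : 0 < gap by rewrite mulr_gt0 ?subr_gt0 ?l_mono// exprn_even_gt0.
  (* The energy bound gives l N * E v^2 >= sum of l m * beta m^2 >= l N * B n + gap: terms below [N]
     vanish, and those above [N] have l m > l N. The Parseval remainder tends to 0, which excludes a
     positive gap. *)
  have gapn n : (m0 < n)%N -> gap <= l N * (E (fun x => v x ^+ 2) - B n).
    move=> m0n; rewrite mulrBr lerBrDr.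
    apply: le_trans Ev; apply: le_trans (energy n).
    rewrite /B mulr_sumr (bigD1 (Ordinal m0n))//= [leRHS](bigD1 (Ordinal m0n))//=.
    rewrite addrA lerD//; first by rewrite /gap mulrBl subrK.
    apply: ler_sum => m _; have [mN|Nm] := ltnP m N.
      by rewrite beta0// expr0n/= !mulr0.
    rewrite ler_wpM2r ?sqr_ge0//; move: Nm; rewrite leq_eqVlt => /predU1P[<-//|Nm].
    by rewrite ltW ?l_mono.
  have limN : (fun n => l N * (E (fun x => v x ^+ 2) - B n)) @ \oo --> 0.
    by rewrite -(mulr0 (l N)); apply: cvgM; [exact: cvg_cst|exact: lim].
  suff : gap <= 0 by rewrite leNgt gap0.
  apply: (cvgr_to_ge limN).
  by exists m0.+1 => // n /= m0n; exact: gapn.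
have B1 n : (N < n)%N -> B n = beta N ^+ 2.
  move=> Nn; rewrite /B (bigD1 (Ordinal Nn))//= big1 ?addr0// => m mN.
  have [lt|gt|eq] := ltngtP m N.
  - by rewrite beta0// expr0n.
  - by rewrite beta_gt// expr0n.
  - by move/negP: mN; case; apply/eqP/val_inj.
have -> : E (fun x => (v x - beta N * e N x) ^+ 2) =
    E (fun x => (v x - \sum_(m < N.+1) beta m * e m x) ^+ 2).
  apply: eq_Rintegral => x _; congr ((_ - _) ^+ 2).
  rewrite big_ord_recr/= big1 ?add0r// => m _.
  by rewrite beta0 ?mul0r.
rewrite parseval B1//.
apply/eqP; rewrite eq_le; apply/andP; split.
  by apply: (cvgr_to_ge lim); exists N.+1 => // n /= Nn; rewrite B1.
by apply: (cvgr_to_le lim); exists N.+1 => // n /= Nn; rewrite B1.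
Unshelve. all: by end_near. Qed.

(** The combination of restrictions is [s * e N] for a step function [s]. Being equal to
    [beta N * e N] in L^2, it forces every step to be [beta N]; but the last step is 0 and another
    one is not. *)
Lemma courant N : ~ has_zeros a b N.+1 (e N).
Proof.
move=> [z [zlt z0]].
have [de dp pa pb] := ep N.
have eN_neq0 x : x \in `[a, b] -> e N x = 0 -> p N x <> 0.
  move=> xab ex px.
  have := expect_indic_sqr_gt0 N (lexx a) ab (lexx b).
  rewrite (@eq_Rintegral _ _ _ _ _ (fun=> 0)) ?Rintegral_cst ?mul0r ?ltxx//.
  move=> y; rewrite inE => yab.
  by rewrite (regular_eigenpair_unique cr r_gt0 (ep N) xab ex px yab) expr0n mulr0.
(* All zeros are interior, since the flux already vanishes at [a] and [b]. Hence N + 1 zeros cut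
   [a, b] into N + 2 nondegenerate intervals, numbered 0 to N + 1. *)
have az : a < z 0%N.
  have [] := z0 0%N isT; rewrite in_itv/= => /andP[az _] ez.
  rewrite lt_neqAle az andbT; apply/eqP => za.
  by apply: (eN_neq0 a _ _ pa); [rewrite bound_itvE ltW|rewrite za].
have zb : z N < b.
  have [] := z0 N (ltnSn N); rewrite in_itv/= => /andP[_ zb] ez.
  rewrite lt_neqAle zb andbT; apply/eqP => za.
  by apply: (eN_neq0 b _ _ pb); [rewrite bound_itvE ltW|rewrite -za].
pose w i := if i is j.+1 then (if j == N.+1 then b else z j) else a.
have wlt i : (i < N.+2)%N -> w i < w i.+1.
  case: i => [_|i iN] //=.
  rewrite ltnS in iN; rewrite (ltn_eqF iN).
  by case: eqVneq => [[->]//|iN']; apply: zlt; rewrite ltn_neqAle iN' iN.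
have w_homo i j : (i <= j <= N.+2)%N -> w i <= w j.
  move=> /andP[]; elim: j => [|j IH]; first by rewrite leqn0 => /eqP->.
  rewrite leq_eqVlt => /predU1P[->//|ij] jN.
  by rewrite (le_trans (IH ij (ltnW jN)))// ltW// wlt.
have aw i : (i <= N.+2)%N -> a <= w i by move=> iN; apply: (w_homo 0%N).
have wb i : (i <= N.+2)%N -> w i <= b.
  by move=> iN; rewrite (le_trans (w_homo i N.+2 _)) ?iN ?leqnn//= eqxx.
have pw m i : (i <= N.+2)%N -> p m (w i) * e N (w i) = 0.
  have [_ _ pma pmb] := ep m.
  case: i => [|i iN] /=; first by rewrite pma mul0r.
  case: eqVneq => [_|iN']; first by rewrite pmb mul0r.
  have iN1 : (i < N.+1)%N by rewrite ltn_neqAle iN' -ltnS.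
  by have [_ ->] := z0 _ iN1; rewrite mulr0.
pose chi i x : R := (x \in `]w i, w i.+1])%:R.
have mchi i : bounded_measurable a b (chi i) by exact: bounded_measurable_indic.
have chi_disj i j x : (i < N.+2)%N -> (j < N.+2)%N -> i != j -> chi i x * chi j x = 0.
  wlog ij : i j / (i < j)%N => [H iN jN|iN jN _].
    rewrite neq_ltn => /orP[] ij; first by apply: H => //; rewrite ltn_eqF.
    by rewrite mulrC; apply: H => //; rewrite ltn_eqF.
  rewrite /chi; case: (boolP (x \in `]w i, w i.+1])) => [|_]; last by rewrite mul0r.
  rewrite !in_itv/= => /andP[_ xi]; case: (boolP (_ && _)) => [/andP[jx _]|_];
    last by rewrite mulr0.
  have := w_homo i.+1 j; rewrite ij (ltnW jN) => /(_ isT) wij.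
  by have := lt_le_trans jx (le_trans xi wij); rewrite ltxx.
pose J i m := E (fun x => chi i x * (e N x * e m x)).
(* N + 1 coefficients are enough to satisfy the N orthogonality conditions *)
have [dd [dd0 [i0 [i0N ddi0]] ddJ]] : exists dd : nat -> R,
    [/\ dd N.+1 = 0, exists i0, (i0 < N.+1)%N /\ dd i0 != 0 &
     forall m, (m < N)%N -> \sum_(i < N.+2) dd i * J i m = 0].
  pose A : 'M[R]_(N.+1, N) := \matrix_(i, m) J i m.
  have /rowV0Pn[u /sub_kermxP uA u0] : kermx A != 0.
    rewrite kermx_eq0 /row_free; apply/negP => /eqP rA.
    by have := rank_leq_col A; rewrite rA ltnn.
  have [k uk] : exists k, u 0 k != 0.
    by apply/existsP; apply: contraNT u0 => /existsPn H; apply/eqP/rowP => k;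
      rewrite mxE; apply/eqP/negPn/H.
  exists (fun i => if (i < N.+1)%N then u 0 (inord i) else 0); split.
  - by rewrite ltnn.
  - by exists k; rewrite ltn_ord inord_val.
  - move=> m mN; rewrite big_ord_recr/= ltnn mul0r addr0.
    have /rowP/(_ (Ordinal mN)) := uA; rewrite !mxE => H; rewrite -[RHS]H.
    apply: eq_bigr => i _; rewrite ltn_ord inord_val !mxE; congr (_ * J _ _).
pose s x := \sum_(i < N.+2) dd i * chi i x.
have ms : bounded_measurable a b s.
  by apply: (@bounded_measurable_sum _ _ _ N.+2 (fun i x => dd i * chi i x)) => i;
    exact: bounded_measurableZ.
have chis i x : (i < N.+2)%N -> chi i x * s x = chi i x * dd i.
  move=> iN; rewrite /s (bigD1 (Ordinal iN))//= mulrDr big_distrr/= big1 ?addr0.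
    rewrite mulrCA /chi; case: (_ \in _); rewrite /= ?mul0r ?mulr0 ?mul1r ?mulr1//.
  by move=> j ji; rewrite mulrCA chi_disj ?mulr0// eq_sym.
have Es h : bounded_measurable a b h ->
    E (fun x => s x * h x) = \sum_(i < N.+2) dd i * E (fun x => chi i x * h x).
  move=> mh.
  have mc i : bounded_measurable a b (fun x => dd i * (chi i x * h x)).
    by apply/bounded_measurableZ/bounded_measurableM.
  transitivity (E (fun x => \sum_(i < N.+2) dd i * (chi i x * h x))).
    by apply: eq_Rintegral => x _; rewrite mulr_suml; apply: eq_bigr => i _; rewrite mulrA.
  rewrite (expect_sum mu N.+2 mc); apply: eq_bigr => i _.
  by rewrite expectZ//; exact: bounded_measurableM.
have key i m : (i < N.+2)%N ->
    E (fun x => chi i x * (p N x / r x * (p m x / r x))) = l m * J i m.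
  move=> iN; apply: energy_itv; [exact/aw/ltnW|exact/ltW/wlt|exact: wb|..].
    exact/pw/ltnW.
  exact: pw.
pose v x := s x * e N x.
pose dv x := s x * (p N x / r x).
pose beta m := E (fun x => v x * e m x).
have mE m := bounded_measurable_eigen m.
have mF m := bounded_measurable_flux m.
have mv : bounded_measurable a b v by exact: bounded_measurableM.
have mdv : bounded_measurable a b dv by exact: bounded_measurableM.
have betaE m : beta m = \sum_(i < N.+2) dd i * J i m.
  rewrite -Es; last exact: bounded_measurableM.
  by apply: eq_Rintegral => x _; rewrite mulrA.
have dvE m : E (fun x => dv x * (p m x / r x)) = l m * beta m.
  rewrite betaE mulr_sumr.
  transitivity (E (fun x => s x * (p N x / r x * (p m x / r x)))).
    by apply: eq_Rintegral => x _; rewrite /dv !mulrA.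
  rewrite Es; last exact: bounded_measurableM.
  by apply: eq_bigr => i _; rewrite key// mulrCA.
have s2 h : bounded_measurable a b h -> E (fun x => s x ^+ 2 * h x) =
    \sum_(i < N.+2) dd i ^+ 2 * E (fun x => chi i x * h x).
  move=> mh.
  transitivity (E (fun x => s x * (s x * h x))).
    by apply: eq_Rintegral => x _; rewrite expr2 mulrA.
  rewrite Es; last exact: bounded_measurableM.
  apply: eq_bigr => i _; rewrite expr2 -mulrA; congr (_ * _).
  rewrite -expectZ; last exact: bounded_measurableM.
  by apply: eq_Rintegral => x _; rewrite mulrA chis// mulrAC mulrC.
(* On each nodal interval the energy of [e N] is [l N] times its mass, so the bound is an equality
   whatever the coefficients [dd]. *)
have dv2 : E (fun x => dv x ^+ 2) <= l N * E (fun x => v x ^+ 2).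
  rewrite le_eqVlt; apply/orP; left; apply/eqP.
  transitivity (E (fun x => s x ^+ 2 * (p N x / r x * (p N x / r x)))).
    by apply: eq_Rintegral => x _; rewrite -expr2 -exprMn.
  rewrite s2; last exact: bounded_measurableM.
  transitivity (l N * E (fun x => s x ^+ 2 * (e N x * e N x))).
    rewrite s2; last exact: bounded_measurableM.
    by rewrite mulr_sumr; apply: eq_bigr => i _; rewrite key// mulrCA.
  by congr (_ * _); apply: eq_Rintegral => x _; rewrite -expr2 -exprMn.
have beta0 m : (m < N)%N -> beta m = 0 by move=> mN; rewrite betaE ddJ.
have vN := min_energy_eigen mv mdv (fun m => erefl) dvE dv2 beta0.
(* On the interval of index [i], v - beta N * e N equals (dd i - beta N) * e N, and [e N] has
   positive mass there. *)
have ddE i : (i < N.+2)%N -> dd i = beta N.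
  move=> iN; have iN' := ltnW iN.
  have pos := expect_indic_sqr_gt0 N (aw _ iN') (wlt _ iN) (wb _ iN).
  have mce : bounded_measurable a b (fun x => chi i x * e N x ^+ 2).
    by apply: bounded_measurableM => //; under eq_fun do rewrite expr2; exact: bounded_measurableM.
  have mve : bounded_measurable a b (fun x => v x - beta N * e N x).
    under eq_fun do rewrite -mulNr; apply: bounded_measurableD => //.
    exact: bounded_measurableZ.
  have : (dd i - beta N) ^+ 2 * E (fun x => chi i x * e N x ^+ 2) <= 0.
    rewrite -vN -expectZ//; apply: le_Rintegral => //.
    - by apply: bounded_measurable_integrable; exact: bounded_measurableZ.
    - apply: bounded_measurable_integrable.
      by under eq_fun do rewrite expr2; exact: bounded_measurableM.
    move=> x _; have := chis i x iN; rewrite /v /chi.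
    case: (_ \in _); rewrite /= ?mul0r ?mulr0 ?sqr_ge0// !mul1r => ->.
    by rewrite -mulrBl exprMn.
  rewrite pmulr_lle0// => H; apply/eqP; rewrite -subr_eq0 -sqrf_eq0.
  by rewrite eq_le H sqr_ge0.
move: ddi0; rewrite ddE ?(ltnW i0N)//; last by rewrite ltnW// ltnS.
by rewrite -(ddE N.+1)// dd0 eqxx.
Qed.

End Courant.

(** * The Chebyshev property of the basis and its discrete consequences *)

Section PoincareChebyshev.
Context {R : realType}.
Variables (a b : R) (mu : probability (measurableTypeR R) R).
Hypotheses (ab : a < b) (hmu : bounded_perturbation_of_uniform a b mu).
Variables (lambda : nat -> R) (phi : nat -> R -> R).
Hypothesis hphi : poincare_basis a b mu lambda phi.

Lemma poincare_basis_regular : exists (r : R -> R) (e p : nat -> R -> R),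
  [/\ continuous r, forall x, 0 < r x, has_density a b mu r,
      forall m, regular_eigenpair a b r (lambda m) (e m) (p m) &
      forall m x, x \in `[a, b] -> phi m x = e m x].
Proof.
have [r [cr r_gt0 mur]] := bounded_perturbation_density ab hmu.
have H m : exists ep : (R -> R) * (R -> R),
    regular_eigenpair a b r (lambda m) ep.1 ep.2 /\
    forall x, x \in `[a, b] -> phi m x = ep.1 x.
  have [e [p [ep phie]]] := eigenfunction_regular cr r_gt0 mur ab (pb_eigen hphi m).
  by exists (e, p).
have [ep Hep] := choice H.
exists r, (fun m => (ep m).1), (fun m => (ep m).2); split => //.
  by move=> m; have [] := Hep m.
by move=> m; have [] := Hep m.
Qed.

Lemma bounded_measurable_L2 f : bounded_measurable a b f -> L2 a b mu f.
Proof.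
move=> mf; split; first by apply: measurable_funTS; exact: mf.1.
apply: bounded_measurable_integrable.
by under eq_fun do rewrite expr2; exact: bounded_measurableM.
Qed.

(** A nonzero top coefficient would pass the N + 1 zeros on to the top eigenfunction, against
    Courant's bound. So it is zero, and the shorter combination keeps enough zeros for the
    induction, which ends at phi 0 = 1. *)
Lemma poincare_chebyshev N (c : nat -> R) :
  has_zeros a b N.+1 (fun x => \sum_(m < N.+1) c m * phi m x) ->
  forall m, (m <= N)%N -> c m = 0.
Proof.
have [r [e [p [cr r_gt0 mur ep phie]]]] := poincare_basis_regular.
have dotE f m : dotL2 a b mu f (phi m) = Rintegral mu `[a, b]%classic (fun x => f x * e m x).
  by apply: eq_Rintegral => x; rewrite inE => xab; rewrite phie.
have orth i j : Rintegral mu `[a, b]%classic (fun x => e i x * e j x) = (i == j)%:R.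
  rewrite -dotE -(pb_orthonormal hphi).
  by apply: eq_Rintegral => x; rewrite inE => xab; rewrite -phie.
have total f : bounded_measurable a b f -> (fun n => Rintegral mu `[a, b]%classic
    (fun x => (f x - \sum_(m < n) Rintegral mu `[a, b]%classic
        (fun y => f y * e m y) * e m x) ^+ 2)) @ \oo --> 0.
  move=> mf; have := pb_total hphi (bounded_measurable_L2 mf).
  apply: cvg_trans; apply: near_eq_cvg; near=> n.
  apply: eq_Rintegral => x; rewrite inE => xab /=; rewrite -expr2.
  by congr ((_ - _) ^+ 2); apply: eq_bigr => m _; rewrite dotE phie.
have l0 := pb_lambda0 hphi; have l_lt := pb_lambda_lt hphi.
elim: N => [|N IH] zN.
  move=> m; rewrite leqn0 => /eqP->.
  have [z [_ /(_ 0%N isT)[zab]]] := zN.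
  by rewrite big_ord1 (pb_phi0 hphi)// mulr1.
have cN : c N.+1 = 0.
  apply/eqP/negPn/negP => cN.
  apply: (courant ab cr r_gt0 mur ep l_lt orth total (N := N.+1)).
  apply: (has_zeros_top ab cr r_gt0 ep l0 l_lt (ltn0Sn N) cN).
    apply: contrapT => e0.
    have := orth N.+1 N.+1; rewrite eqxx (@eq_Rintegral _ _ _ _ _ (fun=> 0)).
      by rewrite Rintegral_cst//= mul0r => /eqP; rewrite eq_sym oner_eq0.
    move=> x; rewrite inE => xab; rewrite (_ : e N.+1 x = 0) ?mul0r//.
    by apply/eqP/negPn/negP => ex; apply: e0; exists x.
  case: zN => z [zlt z0]; exists z; split => // i iN; have [zab uz] := z0 _ iN.
  by split => //=; rewrite -[RHS]uz; apply: eq_bigr => m _; rewrite phie.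
move=> m; rewrite leq_eqVlt => /predU1P[->//|]; rewrite ltnS; apply: IH.
case: zN => z [zlt z0]; exists z; split => [i iN|i iN].
  by apply: zlt; exact: ltnW.
have [zab] := z0 _ (ltnW iN).
by rewrite big_ord_recr/= cN mul0r addr0.
Unshelve. all: by end_near. Qed.

Lemma has_zeros_seq (s : seq R) (u : R -> R) : uniq s ->
  {in s, forall x, x \in `[a, b] /\ u x = 0} -> has_zeros a b (size s) u.
Proof.
move=> us s0; exists (nth 0 (sort <=%R s)); split => i iK.
  have := sort_lt_sorted s; rewrite us => /(sorted_ltn_nth lt_trans 0); apply => //.
  - by rewrite inE size_sort ltnW.
  - by rewrite inE size_sort.
by apply: s0; rewrite -(mem_sort <=%R) mem_nth// size_sort.
Qed.

(** A row vector killed by the transposed matrix lists the coefficients of a combination of [K]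
    basis functions that vanishes at [K] distinct nodes. *)
Lemma poincare_sampling_unitmx K (x : 'rV[R]_K) :
  nodes_in a b x -> distinct_nodes x ->
  \matrix_(i < K, m < K) phi m (x 0 i) \in unitmx.
Proof.
case: K x => [|N] x xab xinj; first by rewrite unitmxE det_mx00 unitr1.
rewrite -unitmx_tr -row_free_unit -kermx_eq0.
apply: contraT => /rowV0Pn[u /sub_kermxP uA] /negP; case.
apply/eqP/rowP => m; rewrite mxE.
have := @poincare_chebyshev N (fun m => u 0 (inord m)) _ m (ltn_ord m).
rewrite inord_val; apply.
have := @has_zeros_seq [seq x 0 i | i <- enum 'I_N.+1]
  (fun y => \sum_(m < N.+1) u 0 (inord m) * phi m y).
rewrite size_map size_enum_ord; apply.
  by rewrite map_inj_uniq ?enum_uniq.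
move=> _ /mapP[i _ ->]; split; first exact: xab.
have /rowP/(_ i) := uA; rewrite !mxE => {2}<-.
by apply: eq_bigr => k _; rewrite !mxE inord_val.
Qed.

(** The form for signed discrete measures carried by [s], in which nodes shared by two quadratures
    can be merged into one atom. *)
Lemma poincare_discrete_eq0 (s : seq R) (c : R -> R) :
  uniq s -> {in s, forall x, x \in `[a, b]} ->
  (forall m, (m < size s)%N -> \sum_(x <- s) c x * phi m x = 0) ->
  {in s, forall x, c x = 0}.
Proof.
move=> us sab c0 x xs.
pose X : 'rV[R]_(size s) := \row_i s`_i.
have Xab : nodes_in a b X by move=> i; rewrite mxE; apply/sab/mem_nth.
have Xinj : distinct_nodes X.
  by move=> i j; rewrite !mxE => /eqP; rewrite nth_uniq// => /eqP/val_inj.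
have U := poincare_sampling_unitmx Xab Xinj.
pose C : 'rV[R]_(size s) := \row_i c s`_i.
have : C *m (\matrix_(i < size s, m < size s) phi m (X 0 i)) = 0.
  apply/rowP => m; rewrite !mxE -[RHS](c0 m (ltn_ord m)).
  by rewrite (big_nth 0) big_mkord; apply: eq_bigr => i _; rewrite !mxE.
move=> CA; have := mulmxK U C; rewrite CA mul0mx => /rowP C0.
have xi : (index x s < size s)%N by rewrite index_mem.
by have := C0 (Ordinal xi); rewrite !mxE/= nth_index// => <-.
Qed.

(** The difference [c] of the two discrete measures has at most 2n atoms, so it vanishes. At a node
    of [X] the weight of [w] is nonzero and must be balanced by a node of [Y] with the same weight.
    The resulting map on indices is injective, hence a permutation. *)
Lemma poincare_quad_unique n (X w Y v : 'rV[R]_n) :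
  nodes_in a b X -> distinct_nodes X -> nodes_in a b Y -> distinct_nodes Y ->
  (forall i, w 0 i != 0) ->
  (forall m, (m < 2 * n)%N -> quad X w (phi m) = quad Y v (phi m)) ->
  exists s : 'S_n, forall i, X 0 i = Y 0 (s i) /\ w 0 i = v 0 (s i).
Proof.
move=> Xab Xinj Yab Yinj w0 XY.
pose sX := [seq X 0 i | i <- enum 'I_n]; pose sY := [seq Y 0 i | i <- enum 'I_n].
pose s := undup (sX ++ sY).
pose c z := \sum_(i < n) w 0 i * (X 0 i == z)%:R - \sum_(i < n) v 0 i * (Y 0 i == z)%:R.
have Xs i : X 0 i \in s by rewrite mem_undup mem_cat map_f ?mem_enum.
have Ys i : Y 0 i \in s by rewrite mem_undup mem_cat [X in _ || X]map_f ?mem_enum ?orbT.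
have us : uniq s by exact: undup_uniq.
have sab : {in s, forall x, x \in `[a, b]}.
  move=> x; rewrite mem_undup mem_cat => /orP[] /mapP[i _ ->]; [exact: Xab|exact: Yab].
have sn : (size s <= 2 * n)%N.
  rewrite (leq_trans (size_undup _))// size_cat /sX /sY !size_map -!enumT !size_enum_ord.
  by rewrite mul2n addnn.
have pick (Z u : 'rV[R]_n) g : (forall i, Z 0 i \in s) ->
    \sum_(z <- s) (\sum_(i < n) u 0 i * (Z 0 i == z)%:R) * g z = quad Z u g.
  move=> Zs; under eq_bigr do rewrite mulr_suml.
  rewrite exchange_big/=; apply: eq_bigr => i _.
  rewrite (bigD1_seq (Z 0 i))//= eqxx mulr1 big1 ?addr0// => z.
  by rewrite eq_sym => /negPf->; rewrite mulr0 mul0r.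
have c0 : {in s, forall z, c z = 0}.
  apply: poincare_discrete_eq0 => // m ms.
  under eq_bigr do rewrite mulrBl.
  rewrite big_split/= sumrN !pick// XY ?subrr//.
  exact: leq_trans sn.
have [f fP] : exists f : 'I_n -> 'I_n, forall i, X 0 i = Y 0 (f i) /\ w 0 i = v 0 (f i).
  have H i : exists j, X 0 i = Y 0 j /\ w 0 i = v 0 j.
    have := c0 _ (Xs i); rewrite /c (bigD1 i)//= eqxx mulr1 big1 ?addr0; last first.
      by move=> k ki; rewrite (negPf (_ : X 0 k != X 0 i)) ?mulr0// (inj_eq Xinj).
    move=> /eqP; rewrite subr_eq0 => /eqP wi.
    have [j /eqP Yj] : exists j, Y 0 j == X 0 i.
      apply/existsP; apply: contraT => /existsPn HY.
      have := w0 i; rewrite wi big1 ?eqxx// => j _.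
      by rewrite (negPf (HY j)) mulr0.
    exists j; split=> //; rewrite wi (bigD1 j)//= Yj eqxx mulr1 big1 ?addr0// => k kj.
    by rewrite -Yj (negPf (_ : Y 0 k != Y 0 j)) ?mulr0// (inj_eq Yinj).
  by have [f fP] := choice H; exists f.
have finj : injective f.
  by move=> i j fij; apply: Xinj => /=; rewrite (fP i).1 (fP j).1 fij.
by exists (perm finj) => i; rewrite permE; exact: fP.
Qed.

End PoincareChebyshev.

(** * Reproducing kernel and worst-case error *)

Section ReproducingKernel.
Context {R : realType}.
Variables (D : set R) (kappa : R -> R -> R) (H : rkhs D kappa).
Implicit Types f g h : R -> R.

Lemma rk_memZ c f : rk_mem H f -> rk_mem H (fun x => c * f x).
Proof.
move=> Hf; have := rk_memL c Hf (rk_mem0 H).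
by under eq_fun do rewrite addr0.
Qed.

Lemma rk_mem_sum n (c : nat -> R) (f : nat -> R -> R) :
  (forall i, (i < n)%N -> rk_mem H (f i)) ->
  rk_mem H (fun x => \sum_(i < n) c i * f i x).
Proof.
elim: n => [|n IH] Hf.
  by under eq_fun do rewrite big_ord0; exact: rk_mem0.
under eq_fun do rewrite big_ord_recr/= addrC.
by apply: rk_memL; [exact: Hf|apply: IH => i ?; apply: Hf; exact: ltnW].
Qed.

Lemma rk_dot0 h : rk_mem H h -> rk_dot H (fun=> 0) h = 0.
Proof.
move=> Hh; have := rk_dotL 1 (rk_mem0 H) (rk_mem0 H) Hh.
rewrite (_ : (fun x : R => 1 * 0 + 0) = fun=> 0); last first.
  by apply/funext => x; rewrite mulr0 addr0.
by rewrite mul1r -[LHS]addr0 => /addrI/esym.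
Qed.

Lemma rk_dotZ c f h : rk_mem H f -> rk_mem H h ->
  rk_dot H (fun x => c * f x) h = c * rk_dot H f h.
Proof.
move=> Hf Hh; have := rk_dotL c Hf (rk_mem0 H) Hh.
by under eq_fun do rewrite addr0; rewrite rk_dot0// addr0.
Qed.

Lemma rk_dot_sum n (c : nat -> R) (f : nat -> R -> R) h :
  (forall i, (i < n)%N -> rk_mem H (f i)) -> rk_mem H h ->
  rk_dot H (fun x => \sum_(i < n) c i * f i x) h = \sum_(i < n) c i * rk_dot H (f i) h.
Proof.
move=> + Hh; elim: n => [|n IH] Hf.
  by rewrite big_ord0; under eq_fun do rewrite big_ord0; exact: rk_dot0.
rewrite big_ord_recr/= addrC; under eq_fun do rewrite big_ord_recr/= addrC.
rewrite rk_dotL//; last 2 first.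
- exact: Hf.
- by apply: rk_mem_sum => i ?; apply: Hf; exact: ltnW.
by rewrite IH// => i ?; apply: Hf; exact: ltnW.
Qed.

Lemma rk_norm0 : rk_norm H (fun=> 0) = 0.
Proof. by rewrite /rk_norm rk_dot0 ?sqrtr0//; exact: rk_mem0. Qed.

Lemma rk_normZ c f : rk_mem H f -> rk_norm H (fun x => c * f x) = `|c| * rk_norm H f.
Proof.
move=> Hf; have Hcf := rk_memZ c Hf.
rewrite /rk_norm rk_dotZ// rk_dotC// rk_dotZ// mulrA -expr2.
by rewrite sqrtrM ?sqr_ge0// sqrtr_sqr.
Qed.

End ReproducingKernel.

(** * Zero worst-case error as exactness on the whole space *)

Section WorstCaseError.
Context {R : realType}.
Variables (a b : R) (mu : probability (measurableTypeR R) R).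
Variables (kappa : R -> R -> R) (H : rkhs `[a, b] kappa).

Lemma wce_ge0 n (X w : 'rV[R]_n) : (0 <= wce mu H X w)%E.
Proof.
apply: ereal_sup_ubound; exists (fun=> 0).
  by split; [exact: rk_mem0|rewrite rk_norm0].
rewrite Rintegral_cst//= mul0r /quad big1 ?subrr ?normr0// => i _.
by rewrite mulr0.
Qed.

Lemma wce_eq0 n (X w : 'rV[R]_n) :
  (forall h, rk_mem H h -> mu.-integrable `[a, b] (EFin \o h)) ->
  wce mu H X w = 0%E <-> forall h, rk_mem H h -> exact_for a b mu X w h.
Proof.
move=> Hint; split=> [w0 h Hh|Hex]; last first.
  apply/eqP; rewrite eq_le wce_ge0 andbT; apply: ge_ereal_sup => _ [h [Hh _] <-].
  by rewrite Hex// subrr normr0.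
(* Scaling by [c] brings [h] into the unit ball; the added 1 covers functions of norm 0. *)
pose c := (rk_norm H h + 1)^-1.
have n0 : 0 <= rk_norm H h by exact: sqrtr_ge0.
have c0 : 0 < c by rewrite invr_gt0 ltr_wpDl.
have : (`|(\int[mu]_(x in `[a, b]) (c * h x)) - quad X w (fun x => c * h x)|%:E <= 0)%E.
  rewrite -w0; apply: ereal_sup_ubound; exists (fun x => c * h x) => //.
  split; first exact: rk_memZ.
  rewrite rk_normZ// gtr0_norm// mulrC ler_pdivrMr ?ltr_wpDl// mul1r.
  by rewrite lerDl.
rewrite lee_fin normr_le0 subr_eq0 => /eqP.
rewrite RintegralZl//; last exact: Hint.
have -> : quad X w (fun x => c * h x) = c * quad X w h.
  by rewrite /quad mulr_sumr; apply: eq_bigr => i _; rewrite mulrCA.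
by move=> /(mulfI (lt0r_neq0 c0)).
Qed.

End WorstCaseError.

(** * The space of the truncated kernel as the span of the first eigenfunctions *)

Section PoincareKernel.
Context {R : realType}.
Variables (a b : R) (mu : probability (measurableTypeR R) R).
Hypotheses (ab : a < b) (hmu : bounded_perturbation_of_uniform a b mu).
Variables (lambda : nat -> R) (phi : nat -> R -> R).
Hypothesis hphi : poincare_basis a b mu lambda phi.

Lemma poincare_weight_gt0 m : 0 < (1 + lambda m)^-1.
Proof.
rewrite invr_gt0 ltr_pwDl//.
exact: eigenvalue_ge0 (pb_lambda0 hphi) (pb_lambda_lt hphi) m.
Qed.

(** Equally spaced points, needed only to have some invertible sampling matrix at hand. *)
Lemma exists_distinct_nodes K : exists x : 'rV[R]_K, nodes_in a b x /\ distinct_nodes x.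
Proof.
exists (\row_i (a + (b - a) * (i%:R / K%:R))); split => [i|i j].
  have K0 : (0 < K)%N by exact: leq_ltn_trans (ltn_ord i).
  have t0 : 0 <= i%:R / K%:R :> R by rewrite divr_ge0.
  have t1 : i%:R / K%:R <= 1 :> R by rewrite ler_pdivrMr ?ltr0n// mul1r ler_nat ltnW.
  have ba : 0 <= b - a by rewrite subr_ge0 ltW.
  by rewrite mxE in_itv/= lerDl mulr_ge0//= -lerBrDl ler_piMr.
have K0 : (0 < K)%N by exact: leq_ltn_trans (ltn_ord i).
rewrite !mxE => /addrI /mulfI; rewrite subr_eq0 gt_eqF// => /(_ isT).
move=> /divIf; rewrite pnatr_eq0 -lt0n => /(_ K0) /eqP.
by rewrite eqr_nat => /eqP/val_inj.
Qed.

Section Space.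
Variables (M : nat) (H : rkhs `[a, b] (KM lambda phi M)).

(** [H] is an arbitrary model of the axioms, so membership must come from kernel sections. The
    section at a node x_i has coefficients alpha_k phi_k(x_i); inverting the sampling matrix at M +
    1 nodes recovers each basis function. *)
Lemma rk_mem_phi m : (m <= M)%N -> rk_mem H (phi m).
Proof.
move=> mM; have [x [xab xinj]] := exists_distinct_nodes M.+1.
have U := poincare_sampling_unitmx ab hmu hphi xab xinj.
set A := \matrix_(i, j) _ in U.
pose m' := Ordinal (mM : m < M.+1)%N.
have -> : phi m = fun y => \sum_(i < M.+1)
    ((1 + lambda m) * invmx A m' (inord i)) * KM lambda phi M (x 0 (inord i)) y.
  apply/funext => y.
  transitivity (\sum_(k < M.+1) (1 + lambda m) * ((invmx A *m A) m' k * ((1 + lambda k)^-1 * phi k y))).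
    rewrite mulVmx// (bigD1 m')//= big1 ?addr0 => [|k km].
      rewrite mxE eqxx mul1r mulrA divff ?mul1r//.
      by have := poincare_weight_gt0 m; rewrite invr_gt0 => /lt0r_neq0.
    by rewrite mxE eq_sym (negPf km) mul0r mulr0.
  under eq_bigr do rewrite mxE mulr_suml mulr_sumr.
  rewrite exchange_big/=; apply: eq_bigr => i _.
  rewrite inord_val /KM mulr_sumr; apply: eq_bigr => k _.
  by rewrite mxE; ring.
by apply: (@rk_mem_sum _ _ _ H M.+1 (fun i => (1 + lambda m) * invmx A m' (inord i))
  (fun i => KM lambda phi M (x 0 (inord i)))) => i _;
  exact/rk_kernel/xab.
Qed.

(** The reproducing property h x = <h, K(x, .)>, with the kernel expanded, exhibits the coefficients
    alpha_m <phi_m, h>. *)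
Lemma rk_mem_span h : rk_mem H h -> exists c : nat -> R,
  forall x, x \in `[a, b] -> h x = \sum_(m < M.+1) c m * phi m x.
Proof.
move=> Hh; exists (fun m => (1 + lambda m)^-1 * rk_dot H (phi m) h) => x xab.
rewrite -(rk_reproducing Hh xab) rk_dotC//; last exact: rk_kernel.
have := @rk_dot_sum _ _ _ H M.+1 (fun m => (1 + lambda m)^-1 * phi m x) phi h
  (fun i iM => rk_mem_phi iM) Hh.
rewrite /KM => ->; apply: eq_bigr => m _.
by rewrite mulrAC.
Qed.

Lemma rk_mem_bounded_measurable h : rk_mem H h -> exists2 g,
  bounded_measurable a b g & forall x, x \in `[a, b] -> h x = g x.
Proof.
move=> /rk_mem_span[c hc].
have [r [e [p [_ _ _ ep phie]]]] := poincare_basis_regular ab hmu hphi.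
exists (fun x => \sum_(m < M.+1) c m * e m x).
  apply: (@bounded_measurable_sum _ _ _ M.+1 (fun m x => c m * e m x)) => m.
  apply/bounded_measurableZ/bounded_measurable_continuous.
  by have [de _ _ _] := ep m; exact: is_derive_continuous de.
by move=> x xab; rewrite hc//; apply: eq_bigr => m _; rewrite phie.
Qed.

Lemma rk_mem_integrable h : rk_mem H h -> mu.-integrable `[a, b] (EFin \o h).
Proof.
move=> /rk_mem_bounded_measurable[g mg hg].
have := bounded_measurable_integrable mu mg.
by apply: eq_integrable => // x; rewrite inE => xab /=; rewrite hg.
Qed.

Lemma wce_eq0P n (X w : 'rV[R]_n) : nodes_in a b X ->
  wce mu H X w = 0%E <-> forall m, (m <= M)%N -> exact_for a b mu X w (phi m).
Proof.
move=> Xab; rewrite wce_eq0; last exact: rk_mem_integrable.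
split=> [Hex m mM|Hex h Hh]; first exact/Hex/rk_mem_phi.
have [c hc] := rk_mem_span Hh.
have [r [e [p [_ _ _ ep phie]]]] := poincare_basis_regular ab hmu hphi.
have me m : bounded_measurable a b (e m).
  apply: bounded_measurable_continuous.
  by have [de _ _ _] := ep m; exact: is_derive_continuous de.
have mce m : bounded_measurable a b (fun x => c m * e m x) by exact: bounded_measurableZ.
rewrite /exact_for /quad.
transitivity (\sum_(m < M.+1) c m * quad X w (phi m)).
  transitivity (Rintegral mu `[a, b]%classic (fun x => \sum_(m < M.+1) c m * e m x)).
    apply: eq_Rintegral => x; rewrite inE => xab; rewrite hc//.
    by apply: eq_bigr => m _; rewrite phie.
  rewrite (expect_sum mu M.+1 mce); apply: eq_bigr => m _.
  rewrite expectZ//; congr (_ * _).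
  have mM : (m <= M)%N by rewrite -ltnS.
  rewrite -(Hex m mM); apply: eq_Rintegral => x; rewrite inE => xab.
  by rewrite phie.
under eq_bigr do rewrite mulr_sumr.
rewrite exchange_big/=; apply: eq_bigr => i _.
rewrite hc ?Xab// mulr_sumr; apply: eq_bigr => m _.
by rewrite mulrCA.
Qed.

(** As n <= M + 1, the first [n] basis functions are available, and their square sampling matrix
    determines the weights. *)
Lemma poincare_weights_unique n (X v w : 'rV[R]_n) : (n <= M.+1)%N ->
  nodes_in a b X -> distinct_nodes X ->
  (forall m, (m <= M)%N -> quad X v (phi m) = quad X w (phi m)) -> v = w.
Proof.
move=> nM Xab Xinj vw; have U := poincare_sampling_unitmx ab hmu hphi Xab Xinj.
rewrite -[v](mulmxK U) -[w](mulmxK U); congr (_ *m _).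
apply/rowP => m; rewrite !mxE.
have mM : (m <= M)%N by rewrite -ltnS (leq_trans (ltn_ord m)).
have := vw m mM; rewrite /quad => vwm.
transitivity (\sum_(i < n) v 0 i * phi m (X 0 i)); first by apply: eq_bigr => i _; rewrite mxE.
by rewrite vwm; apply: eq_bigr => i _; rewrite mxE.
Qed.

(** The quadratic form of the Gram matrix at [u] is the sum of alpha_m (sum_i u_i phi_m(x_i))^2 with
    all alpha_m positive. If it is zero, the weights [u] act on the basis like zero weights, so they
    are zero. *)
Lemma gram_unitmx n (X : 'rV[R]_n) : (n <= M.+1)%N ->
  nodes_in a b X -> distinct_nodes X -> gram (KM lambda phi M) X \in unitmx.
Proof.
move=> nM Xab Xinj; rewrite -row_free_unit -kermx_eq0.
apply: contraT => /rowV0Pn[u /sub_kermxP uG] /negP; case; apply/eqP.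
have quad0 : \sum_(m < M.+1) (1 + lambda m)^-1 * quad X u (phi m) ^+ 2 = 0.
  transitivity ((u *m gram (KM lambda phi M) X *m u^T) 0 0); last by rewrite uG mul0mx mxE.
  rewrite mxE; transitivity (\sum_(j < n) \sum_(i < n) \sum_(m < M.+1)
      (1 + lambda m)^-1 * (u 0 i * phi m (X 0 i)) * (u 0 j * phi m (X 0 j))).
    under [RHS]eq_bigr do rewrite exchange_big/=.
    rewrite exchange_big/=; apply: eq_bigr => m _.
    rewrite expr2 /quad mulrA mulr_sumr; apply: eq_bigr => j _.
    by rewrite mulr_sumr mulr_suml.
  apply: eq_bigr => j _; rewrite !mxE mulr_suml; apply: eq_bigr => i _.
  by rewrite mxE /KM mulr_sumr mulr_suml; apply: eq_bigr => m _; ring.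
have q0 m : (m <= M)%N -> quad X u (phi m) = quad X 0 (phi m).
  move=> mM; rewrite [RHS]big1 => [|i _]; last by rewrite mxE mul0r.
  move/eqP: quad0; rewrite psumr_eq0 => [|k _]; last first.
    by rewrite mulr_ge0 ?sqr_ge0// ltW// poincare_weight_gt0.
  move=> /allP/(_ (Ordinal (mM : m < M.+1)%N)); rewrite mem_index_enum => /(_ isT)/=.
  by rewrite mulf_eq0 (gt_eqF (poincare_weight_gt0 m))/= sqrf_eq0 => /eqP.
exact: poincare_weights_unique q0.
Qed.

End Space.
End PoincareKernel.

Theorem proposition7 (R : realType) (a b : R) (hab : a < b)
    (mu : probability (measurableTypeR R) R)
    (hmu : bounded_perturbation_of_uniform a b mu)
    (lambda : nat -> R) (phi : nat -> R -> R)
    (hphi : poincare_basis a b mu lambda phi)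
    (n : nat) (hn : (1 <= n)%N)
    (H : rkhs `[a, b] (KM lambda phi (2 * n - 1)))
    (XP wP : 'rV[R]_n) (hP : poincare_quadrature a b mu phi XP wP) :
  [/\ wce mu H XP wP = 0%E,
      optimal_quadrature mu H XP wP &
      forall i, 0 < wP 0 i] /\
  (forall X w : 'rV[R]_n,
     kernel_quadrature mu H X w ->
     wce mu H X w = 0%E ->
     (forall i, 0 < w 0 i) ->
     exists s : 'S_n, forall i, X 0 i = XP 0 (s i) /\ w 0 i = wP 0 (s i)) /\
  kernel_quadrature mu H XP wP.
Proof.
have [XPab XPinj wP0 exP] := hP.
have nM : (n <= (2 * n - 1).+1)%N by lia.
have wce0 : wce mu H XP wP = 0%E by apply/(wce_eq0P hab hmu hphi).
split; first by split=> //; split=> // Y v _; rewrite wce0 wce_ge0.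
split=> [X w [Xab Xinj _ _] w0 wpos|].
  have exX := (wce_eq0P hab hmu hphi H w Xab).1 w0.
  apply: (poincare_quad_unique hab hmu hphi) => // [i|m m2n].
    by rewrite gt_eqF.
  by rewrite -exX ?exP//; lia.
split=> //; first exact: (gram_unitmx hab hmu hphi nM).
(* A minimizer does at least as well as [wP], so its error is 0 as well; it is then exact on the
   basis and agrees with [wP] there. *)
move=> v; split=> [vmin|-> u]; last by rewrite wce0 wce_ge0.
have v0 : wce mu H XP v = 0%E.
  by apply/eqP; rewrite eq_le wce_ge0 andbT -wce0.
have exV := (wce_eq0P hab hmu hphi H v XPab).1 v0.
apply: (poincare_weights_unique hab hmu hphi nM) => // m mM.
by rewrite -exV// exP.
Qed.
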